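(* Let $(X,d_X)$ and $(Y,d_Y)$ be two finite metric spaces. Then, for any $k\in\mathbb{Z}_{\ge0}$, $$d_{\mathrm B}\left(\mathcal{B}_{\mathrm{Con},k}(X),\mathcal{B}_{\mathrm{Con},k}(Y)\right)\le\widehat d_{\mathrm B,k}(X,Y)\le\widehat d_{\mathrm I}(X,Y)\le 2\cdot d_{\mathrm{GH}}(X,Y).$$
   Context: Fix a field $\mathbb{F}$. Finite (pseudo-)metric spaces are nonempty. $d_{\mathrm{GH}}$ is the Gromov–Hausdorff distance. Vietoris–Rips FCC. For a finite pseudo-metric space $(X,d_X)$, $C_*(\mathrm{VR}(X))$ is the simplicial chain complex over $\mathbb{F}$ of the full simplex on the vertex set $X$ (points at distance $0$ remain distinct vertices), with filtration function $\ell^X(\sum\lambda_i\sigma_i)=\max_{\lambda_i\ne0}\operatorname{diam}(\sigma_i)$ (distinct simplices $\sigma_i$), $\ell^X(0)=-\infty$. Elements $x_1,\dots,x_r$ are orthogonal if $\ell^X(\sum\lambda_ix_i)=\max_{\lambda_i\ne0}\ell^X(x_i)$ for all scalars. Barcodes. For $k\ge0$, choose orthogonal ordered bases $(y_1,\dots,y_n)$ of $C_{k+1}$ and $(x_1,\dots,x_m)$ of $\ker\partial_k$ such that, with $r=\operatorname{rank}\partial_{k+1}$, $(y_{r+1},\dots,y_n)$ is a basis of $\ker\partial_{k+1}$, $(x_1,\dots,x_r)$ is a basis of $\operatorname{im}\partial_{k+1}$, and $\partial_{k+1}y_i=x_i$ for $i\le r$. The degree-$k$ verbose barcode $\mathcal{B}_{\mathrm{Ver},k}(X)$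 is the multiset of pairs $(\ell^X(x_i),\ell^X(y_i))$, $i\le r$, and $(\ell^X(x_i),\infty)$, $r<i\le m$; it does not depend on the choices. The concise barcode $\mathcal{B}_{\mathrm{Con},k}(X)$ is its sub-multiset of pairs $(p,q)$ with $p<q$. Matching and bottleneck distances. $\|(p,q)-(p',q')\|_\infty=\max\{|p-p'|,|q-q'|\}$ if $q,q'<\infty$, $|p-p'|$ if $q=q'=\infty$ (with $|\infty-\infty|=0$), $\infty$ otherwise. $d_{\mathrm M}(A,B)=\inf_\phi\sup_{a\in A}\|a-\phi(a)\|_\infty$ over bijections of multisets $\phi:A\to B$ ($\infty$ if there is none, $0$ if both are empty). $d_{\mathrm B}(A,B)=d_{\mathrm M}(A\sqcup\Delta^\infty,B\sqcup\Delta^\infty)$, where $\Delta^\infty$ is the multiset containing each $(r,r)$, $r\in[0,\infty]$, with countably infinite multiplicity. Interleaving distance. For filtered chain complexes $(C_*,\ell_C)$, $(D_*,\ell_D)$ put $C_*^t=\{x:\ell_C(x)\le t\}$. They are $\delta$-interleaved if there are chain maps $f_t:C_*^t\to D_*^{t+\delta}$, $g_t:D_*^t\to C_*^{t+\delta}$ ($t\in\mathbb{R}$) commuting with the inclusions, with $g_{t+\delta}f_t$ and $f_{t+\delta}g_t$ equal to the inclusions $C_*^t\hookrightarrow C_*^{t+2\delta}$, $D_*^t\hookrightarrow D_*^{t+2\delta}$; $d_{\mathrm I}$ is the infimum of such $\delta\ge0$. Pullback distances. A finite tripod between $X$ and $Y$ is a finite set $Z$ with surjections $\phi_X:Z\to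 X$, $\phi_Y:Z\to Y$. $Z_X$ denotes $Z$ with the pseudo-metric $(z,z')\mapsto d_X(\phi_X(z),\phi_X(z'))$; similarly $Z_Y$. Define $\widehat d_{\mathrm B,k}(X,Y)=\inf d_{\mathrm M}(\mathcal{B}_{\mathrm{Ver},k}(Z_X),\mathcal{B}_{\mathrm{Ver},k}(Z_Y))$ and $\widehat d_{\mathrm I}(X,Y)=\inf d_{\mathrm I}(C_*(\mathrm{VR}(Z_X)),C_*(\mathrm{VR}(Z_Y)))$, both infima over finite tripods. *)

(* Defs.v *)
From HB Require Import structures.
From mathcomp Require Import all_boot all_order all_algebra.
From mathcomp Require Import all_classical all_reals all_analysis.

Set Implicit Arguments.
Unset Strict Implicit.
Unset Printing Implicit Defensive.

Import Order.TTheory GRing.Theory Num.Theory.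

Local Open Scope classical_set_scope.
Local Open Scope ring_scope.

(* The topological part of Metric is determined by the distance (a ball is
   {y | mdist x y < e}), so this is a finite type with a distance.
   The empty type is not excluded. *)
#[short(type="finMetricType")]
HB.structure Definition FinMetric (R : numDomainType) :=
  { T of Finite T & Metric R T }.

(* The library's pseudoMetricType has entourages and balls but no distance
   function, hence this record. *)
Record pseudometric (R : realType) (T : Type) := PseudometricDist {
  pdist :> T -> T -> R;
  pdistxx : forall x, pdist x x = 0;
  pdist_sym : forall x y, pdist x y = pdist y x;
  pdist_triangle : forall x y z, pdist x z <= pdist x y + pdist y z
}.

Lemma pdist_ge0 (R : realType) (T : Type) (d : pseudometric R T) x y :
  0 <= d x y.
Proof.
have := pdist_triangle d x y x.
by rewrite pdistxx (pdist_sym d y x) -mulr2n pmulrn_lge0.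
Qed.

Definition metric_pseudometric (R : realType) (X : metricType R) :
  pseudometric R X :=
  PseudometricDist (@mdistxx R X) (@metric_sym R X) (@metric_triangle R X).

Definition pullback (R : realType) (Z X : Type) (d : pseudometric R X)
    (phi : Z -> X) : pseudometric R Z :=
  @PseudometricDist R Z (fun z z' => d (phi z) (phi z'))
    (fun z => pdistxx d (phi z))
    (fun z z' => pdist_sym d (phi z) (phi z'))
    (fun z z' z'' => pdist_triangle d (phi z) (phi z') (phi z'')).

Definition hausdorff_dist (R : realType) (W : metricType R) (A B : set W) :
  \bar R :=
  maxe (ereal_sup [set ereal_inf [set (mdist a b)%:E | b in B] | a in A])
       (ereal_sup [set ereal_inf [set (mdist a b)%:E | a in A] | b in B]).

Definition isometric_embedding (R : realType) (X W : metricType R)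
    (i : X -> W) : Prop :=
  forall x x', mdist (i x) (i x') = mdist x x'.

Definition gromov_hausdorff (R : realType) (X Y : metricType R) : \bar R :=
  ereal_inf [set h | exists (W : metricType R) (i : X -> W) (j : Y -> W),
    [/\ isometric_embedding i, isometric_embedding j
      & h = hausdorff_dist (range i) (range j)]].

(* Nonnegatively graded, finite-dimensional in each degree.  [bd k] is the
   differential from degree k.+1 to degree k; the one out of degree 0 is 0.
   The filtration function is given on homogeneous elements. *)
Record fcc (R : realType) (F : fieldType) := FCC {
  chain : nat -> vectType F;
  bd : forall k, 'Hom(chain k.+1, chain k);
  ell : forall k, chain k -> \bar R;
  bd_bd : forall k x, bd k (bd k.+1 x) = 0;
  ell_eqNy : forall k (x : chain k), ell x = -oo%E <-> x = 0;
  ell_lty : forall k (x : chain k), (ell x < +oo)%E;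
  ellZ : forall k a (x : chain k), a != 0 -> ell (a *: x) = ell x;
  ellD : forall k (x y : chain k), (ell (x + y) <= maxe (ell x) (ell y))%E;
  ell_bd : forall k (x : chain k.+1), (ell (bd k x) <= ell x)%E
}.
Arguments chain {R F} C k : rename.
Arguments bd {R F} C k : rename.
Arguments ell {R F} C {k} x : rename.

Section FilteredChainComplex.
Context {R : realType} {F : fieldType}.
Implicit Types C D : fcc R F.

Definition cycles C k : {vspace chain C k} :=
  match k return {vspace chain C k} with
  | 0%N => fullv
  | k'.+1 => lker (bd C k')
  end.

Definition boundaries C k : {vspace chain C k} := limg (bd C k).

Definition orthogonal_chains C k (s : seq (chain C k)) : Prop :=
  forall lam : 'I_(size s) -> F,
    ell C (\sum_(i < size s) lam i *: s`_i) =
    \big[maxe/-oo%E]_(i < size s | lam i != 0) ell C s`_i.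

Record compatible_bases C k (ys : seq (chain C k.+1)) (xs : seq (chain C k))
    : Prop := CompatibleBases {
  cb_orth_y : orthogonal_chains ys;
  cb_orth_x : orthogonal_chains xs;
  cb_basis_y : basis_of fullv ys;
  cb_basis_x : basis_of (cycles C k) xs;
  cb_ker : basis_of (lker (bd C k)) (drop (\dim (boundaries C k)) ys);
  cb_im : basis_of (boundaries C k) (take (\dim (boundaries C k)) xs);
  cb_bd : forall i, (i < \dim (boundaries C k))%N -> bd C k ys`_i = xs`_i
}.

Definition barcode_of_bases C k (ys : seq (chain C k.+1))
    (xs : seq (chain C k)) : seq (\bar R * \bar R) :=
  let r := \dim (boundaries C k) in
  [seq (ell C xs`_i, ell C ys`_i) | i <- iota 0 r] ++
  [seq (ell C x, +oo%E) | x <- drop r xs].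

(* A finite multiset is represented by a list enumerating it.  The one below is
   the barcode of some arbitrarily chosen compatible pair of bases: such pairs
   exist, and the barcodes of any two of them agree up to reordering. *)
Definition verbose_barcode C k : seq (\bar R * \bar R) :=
  xget [::] [set b | exists ys xs,
    @compatible_bases C k ys xs /\ b = barcode_of_bases ys xs].

Definition concise_barcode C k : seq (\bar R * \bar R) :=
  [seq pq <- verbose_barcode C k | (pq.1 < pq.2)%E].

Definition sublevel C k (t : R) : set (chain C k) :=
  [set x | (ell C x <= t%:E)%E].

(* A family of chain maps f t from C^t to D^(t + delta) commuting with the
   inclusions; each f t k is a total function, of which only the values on
   [sublevel C k t] are constrained or used. *)
Record shift_map C D (delta : R)
    (f : R -> forall k, chain C k -> chain D k) : Prop := ShiftMap {
  sm_sub : forall t k x,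
    sublevel t x -> sublevel (t + delta) (f t k x);
  sm_linear : forall t k a x y, sublevel t x -> sublevel t y ->
    f t k (a *: x + y) = a *: f t k x + f t k y;
  sm_bd : forall t k x, sublevel t x ->
    bd D k (f t k.+1 x) = f t k (bd C k x);
  sm_incl : forall s t k x, s <= t -> sublevel s x -> f t k x = f s k x
}.

Definition interleaved C D (delta : R) : Prop :=
  exists (f : R -> forall k, chain C k -> chain D k)
         (g : R -> forall k, chain D k -> chain C k),
    [/\ shift_map delta f, shift_map delta g,
        forall t k x, sublevel t x -> g (t + delta) k (f t k x) = x
      & forall t k x, sublevel t x -> f (t + delta) k (g t k x) = x].

Definition interleaving_dist C D : \bar R :=
  ereal_inf [set delta%:E | delta in
    [set delta | 0 <= delta /\ interleaved C D delta]].

End FilteredChainComplex.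

(* A multiset as an indexed family: a value occurs as often as it is hit. *)
Record multiset (T : Type) := Multiset {
  ms_index : Type;
  ms_elem : ms_index -> T
}.

Definition multiset_of_seq (T : Type) (s : seq T) : multiset T :=
  Multiset (tnth (in_tuple s)).

Definition msum (T : Type) (A B : multiset T) : multiset T :=
  Multiset (fun i : ms_index A + ms_index B =>
    match i with inl a => ms_elem a | inr b => ms_elem b end).

Section MatchingDistance.
Context {R : realType}.
Implicit Types A B : multiset (\bar R * \bar R).

(* In the library +oo - +oo = -oo, so |oo - oo| = 0 has to be imposed. *)
Definition coord_dist (p q : \bar R) : \bar R :=
  if p == q then 0%E else `|p - q|%E.

Definition point_dist (a b : \bar R * \bar R) : \bar R :=
  if (a.2 < +oo)%E && (b.2 < +oo)%E
  then maxe (coord_dist a.1 b.1) (coord_dist a.2 b.2)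
  else if (a.2 == +oo%E) && (b.2 == +oo%E) then coord_dist a.1 b.1
  else +oo%E.

(* The maximum with 0 only matters for empty multisets, because the library's
   supremum of the empty set is -oo. *)
Definition matching_dist A B : \bar R :=
  ereal_inf [set maxe 0%E (ereal_sup (range (fun i : ms_index A =>
      point_dist (ms_elem i) (ms_elem (phi i)))))
    | phi in [set phi : ms_index A -> ms_index B | bijective phi]].

Definition diagonal_multiset : multiset (\bar R * \bar R) :=
  Multiset (fun i : {r : \bar R | (0 <= r)%E} * nat =>
    (sval i.1, sval i.1)).

Definition bottleneck_dist A B : \bar R :=
  matching_dist (msum A diagonal_multiset) (msum B diagonal_multiset).

End MatchingDistance.

Section VietorisRips.
Context {R : realType} (F : fieldType) {T : finType} (d : pseudometric R T).

Definition diam (s : {set T}) : R :=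
  \big[Order.max/0]_(u in s) \big[Order.max/0]_(v in s) d u v.

Definition simplex k := {s : {set T} | #|s| == k.+1}.

Definition vr_chain k : vectType F := {ffun simplex k -> F^o}.

(* Simplices are oriented by the order in which the finType T is enumerated;
   another order gives an isomorphic complex with the same filtration. *)
Definition vertex_pos (s : {set T}) (v : T) : nat :=
  #|[pred u in s | (enum_rank u < enum_rank v)%N]|.

Definition simplex_bd k (s : {set T}) : vr_chain k :=
  \sum_(v in s) (-1) ^+ vertex_pos s v *:
    [ffun t : simplex k => (val t == s :\ v)%:R].

Definition vr_bd_fun k (c : vr_chain k.+1) : vr_chain k :=
  \sum_s c s *: simplex_bd k (val s).

Fact vr_bd_linear k : linear (@vr_bd_fun k).
Proof.
move=> a x y; rewrite /vr_bd_fun scaler_sumr -big_split/=.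
apply: eq_bigr => s _; by rewrite !ffunE scalerDl scalerA.
Qed.

HB.instance Definition _ k :=
  GRing.isLinear.Build F (vr_chain k.+1) (vr_chain k) _ (@vr_bd_fun k)
    (@vr_bd_linear k).

Definition vr_bd k : 'Hom(vr_chain k.+1, vr_chain k) := linfun (@vr_bd_fun k).

Definition vr_ell k (c : vr_chain k) : \bar R :=
  \big[maxe/-oo%E]_(s | c s != 0) (diam (val s))%:E.

Definition vr_inc (s t : {set T}) : F :=
  \sum_(v in s) (-1) ^+ vertex_pos s v * (t == s :\ v)%:R.

Lemma vr_bdE k c (t : simplex k) : vr_bd k c t = \sum_s c s * vr_inc (val s) (val t).
Proof.
rewrite lfunE/= /vr_bd_fun sum_ffunE; apply: eq_bigr => s _.
rewrite !ffunE/= sum_ffunE; congr (_ * _); apply: eq_bigr => v _.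
by rewrite !ffunE.
Qed.

Lemma sign_vertex_pos (s : {set T}) v w : (enum_rank v < enum_rank w)%N -> v \in s ->
  (-1) ^+ vertex_pos s v * (-1) ^+ vertex_pos (s :\ v) w =
  - ((-1) ^+ vertex_pos s w * (-1) ^+ vertex_pos (s :\ w) v) :> F.
Proof.
move=> vw vs.
have -> : vertex_pos (s :\ w) v = vertex_pos s v.
  apply: eq_card => u; rewrite !inE.
  by case: eqVneq => // ->; rewrite ltnNge (ltnW vw) !andbF.
have -> : vertex_pos s w = (vertex_pos (s :\ v) w).+1.
  rewrite [LHS](cardD1 v) !inE vs vw add1n; congr _.+1.
  by apply: eq_card => u; rewrite !inE andbA.
by rewrite exprS mulN1r mulNr opprK mulrC.
Qed.

Lemma vr_inc_inc k (s : simplex k.+2) (t : simplex k) :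
  \sum_(r : simplex k.+1) vr_inc (val s) (val r) * vr_inc (val r) (val t) = 0.
Proof.
case: s t => s /= cs [t /= ct].
pose a v w : F := (-1) ^+ vertex_pos s v * (-1) ^+ vertex_pos (s :\ v) w *
   (t == s :\ v :\ w)%:R.
transitivity (\sum_(v in s) \sum_(w in s | w != v) a v w).
  under eq_bigr do rewrite mulr_suml.
  rewrite exchange_big/=; apply: eq_bigr => v vs.
  have csv : #|s :\ v| == k.+2 by move: cs; rewrite (cardsD1 v) vs.
  pose sv : simplex k.+1 := exist (fun r : {set T} => #|r| == k.+2) _ csv.
  rewrite (bigD1 sv)//= big1 => [|r rN]; last first.
    rewrite [_ == _](_ : _ = false) ?mulr0 ?mul0r//.
    by apply/negbTE; apply: contra rN => /eqP rE; apply/eqP/val_inj.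
  rewrite addr0 eqxx mulr1 mulr_sumr; apply: eq_big => w.
    by rewrite !inE andbC.
  by move=> _; rewrite mulrA.
rewrite (eq_bigr (fun v =>
    \sum_(w in s | (enum_rank v < enum_rank w)%N) a v w +
    \sum_(w in s | (enum_rank w < enum_rank v)%N) a v w)); last first.
  move=> v vs; rewrite (bigID (fun w => (enum_rank v < enum_rank w)%N))/=.
  congr (_ + _); apply: eq_bigl => w; rewrite -andbA; congr (_ && _).
    by case: eqVneq => [->|]//=; rewrite ltnn.
  by rewrite -leqNgt -(inj_eq enum_rank_inj) -(inj_eq val_inj) ltn_neqAle.
rewrite big_split/= [X in _ + X](exchange_big_dep [in s])/=; last first.
  by move=> v w _ /andP[].
rewrite -big_split/= big1// => v vs.
rewrite [X in _ + X](eq_bigl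
  (fun w => (w \in s) && (enum_rank v < enum_rank w)%N)); last first.
  by move=> w; rewrite vs.
rewrite -big_split/= big1// => w /andP[ws vw].
rewrite /a (sign_vertex_pos vw vs) mulNr [s :\ w :\ v]finset.setDDl finset.setUC -finset.setDDl.
by rewrite addNr.
Qed.

Fact vr_bd_bd k x : vr_bd k (vr_bd k.+1 x) = 0.
Proof.
apply/ffunP => t; rewrite vr_bdE ffunE.
under eq_bigr do rewrite vr_bdE mulr_suml.
rewrite exchange_big/= big1// => s _.
under eq_bigr do rewrite -mulrA.
by rewrite -mulr_sumr vr_inc_inc mulr0.
Qed.

Lemma vr_ell_leP k (c : vr_chain k) (e : \bar R) :
  reflect (forall s, c s != 0 -> ((diam (val s))%:E <= e)%E) (vr_ell c <= e)%E.
Proof.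
apply: (iffP (bigmax_leP _ _ _ _)) => [[_ H] s cs|H]; first exact: H.
by split; [exact: leNye|exact: H].
Qed.

Lemma le_vr_ell k (c : vr_chain k) s :
  c s != 0 -> ((diam (val s))%:E <= vr_ell c)%E.
Proof. by move=> cs; move: s cs; exact/vr_ell_leP. Qed.

Fact vr_ell_eqNy k (x : vr_chain k) : vr_ell x = -oo%E <-> x = 0.
Proof.
split=> [xNy|->]; last by rewrite /vr_ell big1// => s; rewrite ffunE eqxx.
apply/ffunP => s; rewrite ffunE; apply/eqP; apply/negPn/negP => /le_vr_ell.
by rewrite xNy.
Qed.

Fact vr_ell_lty k (x : vr_chain k) : (vr_ell x < +oo)%E.
Proof. by apply/bigmax_ltP; split=> // s _; rewrite ltry. Qed.

Fact vr_ellZ k a (x : vr_chain k) : a != 0 -> vr_ell (a *: x) = vr_ell x.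
Proof.
by move=> a0; apply: eq_bigl => s; rewrite ffunE mulf_eq0 negb_or a0.
Qed.

Fact vr_ellD k (x y : vr_chain k) :
  (vr_ell (x + y) <= maxe (vr_ell x) (vr_ell y))%E.
Proof.
apply/vr_ell_leP => s; rewrite ffunE le_max => xy0.
have [x0|/le_vr_ell ->//] := eqVneq (x s) 0.
by rewrite (@le_vr_ell _ y) ?orbT//; move: xy0; rewrite x0 add0r.
Qed.

Lemma diamS (s t : {set T}) : s \subset t -> diam s <= diam t.
Proof.
move=> /fintype.subsetP st; apply/bigmax_leP; split=> [|u us].
  exact: bigmax_ge_id.
apply/bigmax_leP; split=> [|v vs]; first exact: bigmax_ge_id.
apply: le_trans (le_bigmax_cond _ _ (st _ us)).
exact: le_bigmax_cond (st _ vs).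
Qed.

Fact vr_ell_bd k (x : vr_chain k.+1) : (vr_ell (vr_bd k x) <= vr_ell x)%E.
Proof.
apply/vr_ell_leP => t; apply: contra_neqT; rewrite -ltNge => xt.
rewrite vr_bdE big1// => s _; have [->|/le_vr_ell xs] := eqVneq (x s) 0.
  by rewrite mul0r.
rewrite /vr_inc big1 ?mulr0// => v vs; case: eqP => [tE|]; rewrite ?mulr0//.
have : diam (val t) <= diam (val s) by rewrite tE diamS// subD1set.
by rewrite -lee_fin leNgt (le_lt_trans xs xt).
Qed.

Definition VR : fcc R F :=
  FCC vr_bd_bd vr_ell_eqNy vr_ell_lty vr_ellZ vr_ellD vr_ell_bd.

End VietorisRips.

Section PullbackDistances.
Context {R : realType} (F : fieldType).

Definition verbose_bars (T : finType) (d : pseudometric R T) k :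
  multiset (\bar R * \bar R) := multiset_of_seq (verbose_barcode (VR F d) k).

Definition concise_bars (T : finType) (d : pseudometric R T) k :
  multiset (\bar R * \bar R) := multiset_of_seq (concise_barcode (VR F d) k).

Definition pullback_bottleneck (X Y : finMetricType R) (k : nat) : \bar R :=
  ereal_inf [set h | exists (Z : finType) (phiX : Z -> X) (phiY : Z -> Y),
    [/\ set_surj setT setT phiX, set_surj setT setT phiY
      & h = matching_dist
              (verbose_bars (pullback (metric_pseudometric X) phiX) k)
              (verbose_bars (pullback (metric_pseudometric Y) phiY) k)]].

Definition pullback_interleaving (X Y : finMetricType R) : \bar R :=
  ereal_inf [set h | exists (Z : finType) (phiX : Z -> X) (phiY : Z -> Y),
    [/\ set_surj setT setT phiX, set_surj setT setT phiY
      & h = interleaving_dist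
              (VR F (pullback (metric_pseudometric X) phiX))
              (VR F (pullback (metric_pseudometric Y) phiY))]].

End PullbackDistances.

(* Main.v *)
(* An interleaving of filtered complexes whose filtration functions are bounded
   is, at a large level, an isomorphism of chain complexes that moves each
   filtration value by at most delta.  The degree-k verbose barcode is the list
   of pairs (ell x, rho x), where rho x is the least value of ell on the
   preimages of x under the differential (infinite if there are none) and x runs
   over a basis of the cycles that is orthogonal for ell and rho at once; any two
   non-archimedean valuations admit such a basis.  Replacing ell and then rho by
   the transported valuations, one at a time, leaves the other coordinate of the
   bars unchanged, so dimension counts and a sorted matching give a bijection
   that moves each bar by at most delta.
   Along a surjection Z -> X, a duplicated vertex is removed by a prism operator
   that does not increase diameters; the cycles split orthogonally, and on the
   complement of the smaller complex ell = rho, so only diagonal bars are lost.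
   Finally, points of X and Y closer than eta in a common space form a tripod of
   distortion at most 2 eta, for which identity maps are an interleaving. *)

From HB Require Import structures.
Require Import Defs.
From mathcomp Require Import perm lra.
From mathcomp Require Import all_boot all_order all_algebra.
From mathcomp Require Import all_classical all_reals all_analysis.

Set Implicit Arguments.
Unset Strict Implicit.
Unset Printing Implicit Defensive.

Import Order.TTheory GRing.Theory Num.Theory.
Local Open Scope classical_set_scope.
Local Open Scope ring_scope.

(** * Valuations and orthogonal sequences *)

Section Valuations.
Context {R : realType} {F : fieldType}.

(** Descent: moving to a point of smaller value strictly lowers the number of entries of [s] below
    the current value. *)
Lemma finite_argmin (T : Type) (P : T -> Prop) (f : T -> \bar R)
    (s : seq (\bar R)) :
  (forall x, P x -> f x \in s) -> (exists x, P x) ->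
  exists x, P x /\ forall y, P y -> (f x <= f y)%E.
Proof.
move=> fs [x0 Px0].
have [n] := ubnP (count (fun e => (e < f x0)%E) s).
elim: n => // n IHn in x0 Px0 *; rewrite ltnS => nx.
have [[y [Py yx]]|Nx] := pselect (exists y, P y /\ (f y < f x0)%E).
  apply: (IHn y Py); apply: leq_trans nx.
  have /perm_to_rem/permP sE := fs y Py.
  rewrite !sE/= ltxx yx add0n add1n ltnS; apply: sub_count => e ey.
  exact: lt_trans ey yx.
exists x0; split=> // y Py; rewrite leNgt; apply/negP => yx.
by apply: Nx; exists y.
Qed.

Lemma finite_argmax (T : Type) (P : T -> Prop) (f : T -> \bar R)
    (s : seq (\bar R)) :
  (forall x, P x -> f x \in s) -> (exists x, P x) ->
  exists x, P x /\ forall y, P y -> (f y <= f x)%E.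
Proof.
move=> fs /(@finite_argmin _ _ (fun x => - f x)%E (map oppe s)).
case=> [x Px|x [Px xm]]; first by rewrite map_f// fs.
by exists x; split=> // y /xm; rewrite leeN2.
Qed.

(** A non-archimedean norm over the trivially valued field, on a logarithmic scale. The value [+oo]
    is allowed, for the sake of [rho]; [valu_fin] makes extrema attained. *)
Record valuation (V : vectType F) (v : V -> \bar R) : Prop := Valuation {
  valu_eqNy : forall x, v x = -oo%E <-> x = 0;
  valuZ : forall a x, a != 0 -> v (a *: x) = v x;
  valuD : forall x y, (v (x + y)%R <= maxe (v x) (v y))%E;
  valu_fin : exists s : seq (\bar R), forall x, v x \in s
}.

Section ValuationTheory.
Context {V : vectType F} (v : V -> \bar R) (hv : valuation v).

Lemma valu0 : v 0 = -oo%E.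
Proof. exact/(valu_eqNy hv). Qed.

Lemma valuN x : v (- x) = v x.
Proof. by rewrite -scaleN1r (valuZ hv)// oppr_eq0 oner_eq0. Qed.

Lemma valuD_le x y e : (v x <= e)%E -> (v y <= e)%E -> (v (x + y)%R <= e)%E.
Proof. by move=> xe ye; apply: le_trans (valuD hv _ _) _; rewrite ge_max xe. Qed.

Lemma valuB_le x y e : (v x <= e)%E -> (v y <= e)%E -> (v (x - y)%R <= e)%E.
Proof. by move=> xe ye; apply: valuD_le => //; rewrite valuN. Qed.

Lemma valuZ_le a x : (v (a *: x)%R <= v x)%E.
Proof.
by have [->|a0] := eqVneq a 0; rewrite ?scale0r ?valu0 ?leNye// (valuZ hv).
Qed.

End ValuationTheory.

(** A triangular form of orthogonality, suited to induction; [orthogonal_chainsP] identifies it with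
    the maximum formula. *)
Fixpoint orth (V : vectType F) (v : V -> \bar R) (s : seq V) : Prop :=
  if s is x :: s' then
    (forall y, y \in << s'>>%VS -> (v x <= v (x + y)%R)%E) /\ orth v s'
  else True.

Section Orthogonality.
Context {V : vectType F} (v : V -> \bar R) (hv : valuation v).

Lemma orth_consZ x s a y : orth v (x :: s) -> y \in << s>>%VS ->
  (v (a *: x)%R <= v (a *: x + y)%R)%E.
Proof.
have [->|a0] := eqVneq a 0; first by rewrite scale0r valu0// leNye.
move=> [h _] ys; rewrite (valuZ hv)//.
have -> : a *: x + y = a *: (x + a^-1 *: y).
  by rewrite scalerDr scalerA divff// scale1r.
by rewrite (valuZ hv)//; apply: h; rewrite memvZ.
Qed.

Lemma span_filter_sub (p : pred V) s : (<< seq.filter p s>> <= << s>>)%VS.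
Proof. by apply: sub_span => x; rewrite mem_filter => /andP[]. Qed.

Lemma orth_filter p s : orth v s -> orth v (seq.filter p s).
Proof.
elim: s => //= x s IHs [h os]; case: (p x) => /=; last exact: IHs.
split; last exact: IHs.
by move=> y ys; apply: h; apply: subvP ys; exact: span_filter_sub.
Qed.

(** The term of the head [z] is bounded by the whole sum, so subtracting it reduces the claim to the
    tail, whichever of the two subfamilies contains [z]. *)
Lemma orth_filter_split p s x y : orth v s ->
  x \in << seq.filter p s>>%VS -> y \in << seq.filter (predC p) s>>%VS ->
  (v x <= v (x + y)%R)%E.
Proof.
elim: s => [|z s IHs] in x y *.
  by rewrite /= span_nil !memv0 => _ /eqP -> /eqP ->; rewrite addr0.
move=> oz; have [_ os] := oz; have IH := IHs _ _ os.
have fs q : {subset << seq.filter q s>>%VS <= << s>>%VS}.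
  by apply/subvP; exact: span_filter_sub.
rewrite /=; case: (p z) => /=.
  rewrite span_cons => /memv_addP[_ /vlineP[a ->] [x' xs ->]] ys.
  have h := @orth_consZ _ _ a _ oz (memvD (fs _ _ xs) (fs _ _ ys)).
  rewrite -addrA; apply: (valuD_le hv) => //.
  apply: le_trans (IH _ _ xs ys) _.
  rewrite -{1}[x' + y](addrK (a *: z)); apply: (valuB_le hv) => //.
  by rewrite [_ + _ *: _]addrC.
move=> xs; rewrite span_cons => /memv_addP[_ /vlineP[a ->] [y' ys ->]].
have h := @orth_consZ _ _ a _ oz (memvD (fs _ _ xs) (fs _ _ ys)).
apply: le_trans (IH _ _ xs ys) _.
rewrite addrCA -{1}[x + y'](addrK (a *: z)); apply: (valuB_le hv) => //.
  by rewrite [_ + _ *: _]addrC.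
Qed.

Lemma orth_cat s t : orth v s -> orth v t ->
  (forall x y, x \in << s>>%VS -> y \in << t>>%VS -> (v x <= v (x + y)%R)%E) ->
  orth v (s ++ t).
Proof.
elim: s => //= x s IHs [h os] ot st; split; last first.
  apply: IHs => // y z ys; apply: st.
  by rewrite span_cons -[y]add0r memv_add// mem0v.
move=> y; rewrite span_cat => /memv_addP[y1 y1s [y2 y2t ->]].
rewrite addrA; apply: le_trans (h _ y1s) (st _ _ _ y2t).
by rewrite span_cons memv_add// memv_line.
Qed.

Lemma orth_catP s t : orth v (s ++ t) ->
  [/\ orth v s, orth v t &
  (forall x y, x \in << s>>%VS -> y \in << t>>%VS -> (v x <= v (x + y)%R)%E)].
Proof.
elim: s => [|z s IHs].
  move=> ot; split=> // x y; rewrite span_nil memv0 => /eqP -> _.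
  by rewrite valu0// leNye.
move=> oz; have [/= h /IHs[os ot st]] := oz; split=> //.
  split=> // y ys; apply: h; rewrite span_cat.
  by rewrite -[y]addr0 memv_add// mem0v.
move=> x y; rewrite span_cons => /memv_addP[_ /vlineP[a ->] [x' xs ->]] yt.
have h' : (v (a *: z)%R <= v (a *: z + (x' + y))%R)%E.
  by apply: (@orth_consZ _ (s ++ t)) => //; rewrite span_cat memv_add.
rewrite -addrA; apply: (valuD_le hv) => //.
apply: le_trans (st _ _ xs yt) _.
rewrite -{1}[x' + y](addrK (a *: z)); apply: (valuB_le hv) => //.
by rewrite [_ + _ *: _]addrC.
Qed.

Lemma orth_span_ge s e x : orth v s -> (forall y, y \in s -> (e <= v y)%E) ->
  x \in << s>>%VS -> x != 0 -> (e <= v x)%E.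
Proof.
elim: s => [|z s IHs] in x *.
  by rewrite span_nil memv0 => _ _ ->.
move=> oz se; rewrite span_cons => /memv_addP[_ /vlineP[a ->] [y ys ->]].
have [->|a0] := eqVneq a 0.
  rewrite scale0r add0r; apply: IHs => //; first by case: oz.
  by move=> w ws; apply: se; rewrite inE ws orbT.
move=> _; apply: le_trans (orth_consZ a oz ys); rewrite (valuZ hv)//.
by apply: se; rewrite mem_head.
Qed.

End Orthogonality.

(** In an expansion along an orthogonal family no term exceeds the sum, so only vectors below both
    levels occur in that of [x]. *)
Lemma orth2_span_filter (V : vectType F) (v w : V -> \bar R)
    (hv : valuation v) (hw : valuation w) s x a c :
  orth v s -> orth w s -> x \in << s>>%VS -> (v x <= a)%E -> (w x <= c)%E ->
  x \in <<[seq y <- s | (v y <= a)%E && (w y <= c)%E]>>%VS.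
Proof.
elim: s => [|z s IHs] in x *.
  by rewrite span_nil memv0.
move=> ov ow; rewrite span_cons => /memv_addP[_ /vlineP[e ->] [y ys ->]] xa xc.
have vz := le_trans (orth_consZ hv e ov ys) xa.
have wz := le_trans (orth_consZ hw e ow ys) xc.
have yin : y \in <<[seq y <- s | (v y <= a)%E && (w y <= c)%E]>>%VS.
  apply: IHs => //; [by case: ov|by case: ow| |].
    by rewrite -[y](addKr (e *: z)); apply: (valuD_le hv); rewrite ?(valuN hv).
  by rewrite -[y](addKr (e *: z)); apply: (valuD_le hw); rewrite ?(valuN hw).
have [e0|e0] := eqVneq e 0.
  rewrite e0 scale0r add0r; apply: subvP yin.
  by apply: sub_span => u; rewrite !mem_filter inE => /andP[-> ->]; rewrite orbT.
move: vz wz; rewrite (valuZ hv)// (valuZ hw)// => vz wz.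
by rewrite /= vz wz/= span_cons memv_add// memvZ// memv_line.
Qed.

End Valuations.

(** * Bases orthogonal for two valuations *)

Section CommonOrthogonalBasis.
Context {R : realType} {F : fieldType} {V : vectType F}.

(** A subspace of largest dimension inside [P] exhausts it, since adjoining the line of a further
    vector of [P] stays inside [P]. *)
Lemma vspace_of_closed (P : V -> Prop) : P 0 ->
  (forall a x y, P x -> P y -> P (a *: x + y)) ->
  exists W : {vspace V}, forall x, x \in W <-> P x.
Proof.
move=> P0 PD.
pose D n := `[<exists W : {vspace V}, \dim W = n /\ forall x, x \in W -> P x>].
have exD : exists n, D n.
  exists 0%N; apply/asboolP; exists 0%VS; split; first exact: dimv0.
  by move=> x; rewrite memv0 => /eqP ->.
have Dmax n : D n -> (n <= \dim {:V})%N.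
  by move=> /asboolP[W [<- _]]; rewrite dimvS// subvf.
have [n /asboolP[W [Wn WP]] nmax] := ex_maxnP exD Dmax.
exists W => x; split=> [/WP//|Px]; apply/negPn/negP => xW.
have /nmax : D (\dim (<[x]> + W)%VS).
  apply/asboolP; exists (<[x]> + W)%VS; split=> // y.
  by move=> /memv_addP[_ /vlineP[a ->] [z zW ->]]; apply: PD => //; exact: WP.
rewrite -Wn (geq_leqif (dimv_leqif_sup (addvSr _ _))) => /subvP h.
by case/negP: xW; apply/h/(subvP (addvSl _ _)); rewrite memv_line.
Qed.

(* A vector [x] of maximal [v]-value, and among those of minimal [w]-value, is
   orthogonal for both valuations to any hyperplane that contains the vectors
   of smaller [v]-value. *)
Lemma common_orth_basis (v w : V -> \bar R) (hv : valuation v)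
    (hw : valuation w) (U : {vspace V}) :
  exists b : seq V, [/\ basis_of U b, orth v b & orth w b].
Proof.
have [n] := ubnP (\dim U); elim: n => // n IHn in U *; rewrite ltnS => Un.
have [->|U0] := eqVneq U 0%VS.
  by exists [::]; split=> //; exact: nil_basis.
have [sv svP] := valu_fin hv; have [sw swP] := valu_fin hw.
have [xm [xmU xmP]] := @finite_argmax _ _ (fun x => x \in U) _ _
  (fun y _ => svP y)
  (ex_intro _ 0 (mem0v U)).
have exm : exists x, x \in U /\ v x = v xm by exists xm.
have [x [[xU vx] xP]] := @finite_argmin _ _ (fun x => x \in U /\ v x = v xm)
  _ _ (fun y _ => swP y) exm.
(* A nonzero vector of [U] has value above [-oo], hence so has [x]; this puts 0 in the space [A]
   below. *)
have v0 : (-oo < v x)%E.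
  rewrite ltNye; apply/eqP; rewrite vx => vm.
  case/negP: U0; rewrite -vpick0; apply/eqP/(valu_eqNy hv)/eqP.
  rewrite -leeNy_eq -vm; apply: xmP; exact: memv_pick.
have [||A AP] := @vspace_of_closed (fun y => y \in U /\ (v y < v x)%E).
- by rewrite mem0v (valu0 hv).
- move=> a y z [yU yx] [zU zx]; split; first by rewrite memvD// memvZ.
  apply: le_lt_trans (valuD hv _ _) _; rewrite gt_max zx andbT.
  exact: le_lt_trans (valuZ_le hv _ _) yx.
have AU : (A + <[x]> <= U)%VS.
  rewrite subv_add -memvE xU andbT; apply/subvP => y.
  by move=> /(proj1 (AP _))[].
(* Adding to [A] a complement of [A + <[x]>] in [U] gives a hyperplane of [U] that contains [A] but
   not [x]. *)
pose H := (A + (U :\: (A + <[x]>)))%VS.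
have HU : (H <= U)%VS.
  by rewrite subv_add diffvSl andbT (subv_trans _ AU)// addvSl.
have xH : x \notin H.
  apply/negP => /memv_addP[y yA [z zD xE]].
  suff z0 : z = 0.
    by have /AP[_] := yA; rewrite xE z0 addr0 ltxx.
  apply/eqP; rewrite -memv0 -(capv_diff U (A + <[x]>)%VS) memv_cap zD/=.
  rewrite -[z](addKr y) -xE addrC; rewrite addrC memv_add ?memvN//.
  exact: memv_line.
have UE : (<[x]> + H)%VS = U.
  apply/eqP; rewrite eqEsubv subv_add HU -memvE xU/=.
  rewrite /H addvA [(<[x]> + A)%VS]addvC addvC addv_diff.
  exact: addvSl.
have Hn : (\dim H < n)%N.
  apply: leq_trans Un; rewrite ltn_neqAle (dimvS HU) andbT.
  by apply: contra xH => /eqP e; rewrite (_ : H = U)//; apply/eqP; rewrite eqEdim HU e/=.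
have [b [bH ov ow]] := IHn _ Hn; have bE := span_basis bH.
(* A smaller value would put [x + y] in [A], hence [x] in [H]. With maximality of [v x] this gives
   equality, so that minimality of [w x] applies to [x + y]. *)
have vH y : y \in H -> (v x <= v (x + y)%R)%E.
  move=> yH; rewrite leNgt; apply/negP => lt.
  have /AP yA : x + y \in U /\ (v (x + y)%R < v x)%E.
    by split=> //; rewrite memvD// (subvP HU).
  case/negP: xH; rewrite -[x](addrK y) memvB//.
  by rewrite -[x + y]addr0 memv_add// mem0v.
exists (x :: b); split=> /=.
- by rewrite /basis_of span_cons bE UE eqxx free_cons bE xH (basis_free bH).
- by split=> // y; rewrite bE; exact: vH.
- split=> // y; rewrite bE => yH; apply: xP; split.
    by rewrite memvD// (subvP HU).
  apply/eqP; rewrite eq_le -{2}vx vH// andbT; apply: xmP.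
  by rewrite memvD// (subvP HU).
Qed.

End CommonOrthogonalBasis.

(** * Counting basis vectors by their values *)

Section Counting.
Context {R : realType} {F : fieldType} {V : vectType F}.

Lemma valu_span_lt (v : V -> \bar R) (hv : valuation v) (s : seq V) e x :
  (forall y, y \in s -> (v y < e)%E) -> x \in << s>>%VS -> x != 0 ->
  (v x < e)%E.
Proof.
elim: s => [|y s IHs] in x *.
  by rewrite span_nil memv0 => _ ->.
move=> se; rewrite span_cons => /memv_addP[_ /vlineP[a ->] [z zs ->]] _.
have ye : (v y < e)%E by apply: se; rewrite mem_head.
apply: le_lt_trans (valuD hv _ _) _; rewrite gt_max.
rewrite (le_lt_trans (valuZ_le hv _ _) ye)/=.
have [->|] := eqVneq z 0; first by rewrite valu0// (le_lt_trans _ ye)// leNye.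
by apply: IHs => // u us; apply: se; rewrite inE us orbT.
Qed.

Lemma size_filter_dim (U : {vspace V}) (b : seq V) p : basis_of U b ->
  \dim << seq.filter p b>>%VS = count p b.
Proof.
by move=> bU; rewrite -size_filter; apply/eqP/filter_free/(basis_free bU).
Qed.

(** The right-hand count is the dimension of the space where [v' <= a'] and [w <= c], modulo its
    part with [w < c]. The vectors counted on the left span a space that injects into this
    quotient. *)
Lemma count_orth_basis_le (v v' w : V -> \bar R) (hv' : valuation v')
    (hw : valuation w) (U : {vspace V}) (b b' : seq V) a a' c :
  basis_of U b -> orth w b ->
  basis_of U b' -> orth v' b' -> orth w b' ->
  (forall x, x \in U -> (v x <= a)%E -> (v' x <= a')%E) ->
  (count (fun x => (v x <= a)%E && (w x == c)) b <=
   count (fun x => (v' x <= a')%E && (w x == c)) b')%N.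
Proof.
move=> bU ow bU' ov' ow' vv'.
pose p x := (v x <= a)%E && (w x == c).
pose p' x := (v' x <= a')%E && (w x == c).
pose p'_lt x := (v' x <= a')%E && (w x < c)%E.
pose p'_le x := (v' x <= a')%E && (w x <= c)%E.
have pU : (<< seq.filter p b>> <= << seq.filter p'_le b'>>)%VS.
  apply/span_subvP => x; rewrite mem_filter => /andP[/andP[va /eqP wc] xb].
  apply: orth2_span_filter => //.
  - by rewrite (span_basis bU') (basis_mem bU).
  - by apply: vv' => //; rewrite (basis_mem bU).
  - by rewrite wc.
have ltU : (<< seq.filter p'_lt b'>> <= << seq.filter p'_le b'>>)%VS.
  apply: sub_span => x; rewrite !mem_filter => /andP[/andP[va wc] xb].
  by rewrite /p'_le va (ltW wc).
have cap0 : (<< seq.filter p b>> :&: << seq.filter p'_lt b'>> = 0)%VS.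
  apply/eqP; rewrite -subv0; apply/subvP => x; rewrite memv0 => /memv_capP[xp xl].
  apply/negPn/negP => x0.
  have : (c <= w x)%E.
    apply: orth_span_ge xp x0 => //; first exact: orth_filter.
    by move=> y; rewrite mem_filter => /andP[/andP[_ /eqP ->]].
  rewrite leNgt (valu_span_lt _ _ xl)// => y.
  by rewrite mem_filter => /andP[/andP[]].
have : (\dim (<< seq.filter p b>> + << seq.filter p'_lt b'>>) <=
        \dim << seq.filter p'_le b'>>)%N.
  by rewrite dimvS// subv_add pU ltU.
rewrite dimv_disjoint_sum// !(size_filter_dim _ bU, size_filter_dim _ bU').
suff -> : count p'_le b' = (count p' b' + count p'_lt b')%N by rewrite leq_add2r.
rewrite -count_predUI [X in (_ + X)%N](@eq_count _ _ pred0) ?count_pred0 ?addn0.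
  by apply: eq_count => x /=; rewrite /p'_le/= [(w x <= c)%E]le_eqVlt andb_orr.
by move=> x /=; rewrite andbACA andbb; case: ltgtP; rewrite ?andbF.
Qed.

End Counting.

(** * Matchings of multisets *)

Local Notation msum := Defs.msum.

Section MultisetMatching.

(** For [r] equality this is equality of multisets; for [r] a bound on [point_dist] it bounds the
    matching distance. *)
Definition ms_matched (S T : Type) (r : S -> T -> Prop) (A : multiset S)
    (B : multiset T) : Prop :=
  exists2 phi : ms_index A -> ms_index B, bijective phi &
    forall i, r (ms_elem i) (ms_elem (phi i)).

Lemma ms_matched_refl (T : Type) (r : T -> T -> Prop) (A : multiset T) :
  (forall x, r x x) -> ms_matched r A A.
Proof. by move=> rr; exists id => //; exists id. Qed.

Lemma ms_matched_impl (S T : Type) (r1 r2 : S -> T -> Prop) A B :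
  (forall x y, r1 x y -> r2 x y) -> ms_matched r1 A B -> ms_matched r2 A B.
Proof. by move=> r12 [f fb fr]; exists f => // i; exact/r12/fr. Qed.

Lemma ms_matched_trans (S T U : Type) (r1 : S -> T -> Prop)
    (r2 : T -> U -> Prop) (r3 : S -> U -> Prop) B A C :
  (forall x y z, r1 x y -> r2 y z -> r3 x z) ->
  ms_matched r1 A B -> ms_matched r2 B C -> ms_matched r3 A C.
Proof.
move=> r123 [f fb fr] [g gb gr]; exists (g \o f); first exact: bij_comp.
by move=> i; exact: r123 (fr i) (gr _).
Qed.

Lemma ms_matched_sym (S T : Type) (r1 : S -> T -> Prop)
    (r2 : T -> S -> Prop) A B :
  (forall x y, r1 x y -> r2 y x) -> ms_matched r1 A B -> ms_matched r2 B A.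
Proof.
move=> r12 [f [g fg gf] fr]; exists g; first by exists f.
by move=> i; apply: r12; have := fr (g i); rewrite gf.
Qed.

Lemma ms_matched_eql (S T : Type) (r : S -> T -> Prop) A A' B :
  ms_matched eq A A' -> ms_matched r A' B -> ms_matched r A B.
Proof. by apply: ms_matched_trans => ? ? ? ->. Qed.

Lemma ms_matched_eqr (S T : Type) (r : S -> T -> Prop) A B B' :
  ms_matched r A B' -> ms_matched eq B B' -> ms_matched r A B.
Proof.
move=> AB' /(ms_matched_sym (r2 := eq) (fun _ _ => esym)).
by move: AB'; apply: ms_matched_trans => ? ? ? ? <-.
Qed.

Lemma ms_matched_sum (S T : Type) (r : S -> T -> Prop) A A' B B' :
  ms_matched r A B -> ms_matched r A' B' ->
  ms_matched r (msum A A') (msum B B').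
Proof.
move=> [f [f' ff' f'f] fr] [g [g' gg' g'g] gr].
exists (fun i : ms_index A + ms_index A' =>
  match i with inl a => inl (f a) | inr b => inr (g b) end) => [|[]]//.
exists (fun i : ms_index B + ms_index B' =>
  match i with inl a => inl (f' a) | inr b => inr (g' b) end) => -[] i /=;
  by rewrite ?ff' ?f'f ?gg' ?g'g.
Qed.

Lemma ms_sumA (T : Type) (A B C : multiset T) :
  ms_matched eq (msum A (msum B C)) (msum (msum A B) C).
Proof.
exists (fun i : ms_index A + (ms_index B + ms_index C) =>
  match i with
  | inl a => inl (inl a) | inr (inl b) => inl (inr b) | inr (inr c) => inr c
  end); last by move=> [|[]].
by exists (fun i : (ms_index A + ms_index B) + ms_index C =>
  match i with
  | inl (inl a) => inl a | inl (inr b) => inr (inl b) | inr c => inr (inr c)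
  end); [move=> [|[]]|move=> [[]|]].
Qed.

Lemma ms_cat (T : Type) (s t : seq T) :
  ms_matched eq (multiset_of_seq (s ++ t))
    (msum (multiset_of_seq s) (multiset_of_seq t)).
Proof.
exists (fun i : 'I_(size (s ++ t)) => fintype.split (cast_ord (size_cat s t) i)).
  exists (fun i => cast_ord (esym (size_cat s t)) (unsplit i)) => i.
    by rewrite splitK cast_ordK.
  by rewrite cast_ordKV unsplitK.
move=> i; have x0 : T by case: (s ++ t) i => [[]|x].
rewrite /= (tnth_nth x0)/= nth_cat; case: fintype.splitP => j /= ->.
  by rewrite ltn_ord (tnth_nth x0).
by rewrite ltnNge leq_addr/= addKn (tnth_nth x0).
Qed.

Lemma ms_perm (T : eqType) (s t : seq T) : perm_eq s t ->
  ms_matched eq (multiset_of_seq s) (multiset_of_seq t).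
Proof.
move=> /(@tuple_permP _ _ s (in_tuple t))[p sE].
have st : size s = size t by rewrite sE size_tuple.
exists (fun i : 'I_(size s) => p (cast_ord st i)).
  apply: bij_comp; first exact/injF_bij/perm_inj.
  by exists (cast_ord (esym st)) => i; rewrite ?cast_ordK ?cast_ordKV.
move=> i; have x0 : T by case: (s) i => [[]|x].
have /= := congr1 (fun u => nth x0 u i) sE; rewrite /= (tnth_nth x0)/= => ->.
by rewrite -[nat_of_ord i]/(nat_of_ord (cast_ord st i)) nth_mktuple.
Qed.

Lemma ms_matched_cons (S T : Type) (r : S -> T -> Prop) x y s t : r x y ->
  ms_matched r (multiset_of_seq s) (multiset_of_seq t) ->
  ms_matched r (multiset_of_seq (x :: s)) (multiset_of_seq (y :: t)).
Proof.
move=> rxy rst; apply: ms_matched_eql (ms_cat [:: x] s) _.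
apply: ms_matched_eqr (ms_cat [:: y] t); apply: ms_matched_sum => //.
by exists id => [|i]; [exists id|rewrite [i]ord1].
Qed.

End MultisetMatching.

(** * Greedy matching from counting inequalities *)

Section SortedMatching.
Context {R : realType} (h : \bar R -> \bar R)
  (h_homo : {homo h : x y / (x <= y)%E}).
Implicit Types (s t : seq (\bar R * \bar R)).

Let cnt s (a c : \bar R) := count (fun x => (x.1 <= a)%E && (x.2 == c)) s.

Lemma seq_argmin s c : (exists x, x \in s /\ x.2 = c) ->
  exists x, (x \in s /\ x.2 = c) /\
    forall y, y \in s /\ y.2 = c -> (x.1 <= y.1)%E.
Proof.
by apply: (@finite_argmin _ _ _ fst (map fst s)) => x [xs _]; exact: map_f.
Qed.

(** For [c = x.2]: if [x.1 <= a], both counts drop by one, as then [y.1 <= h a]; otherwise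
    minimality of [x] makes the left count zero. *)
Lemma count_rem_le s t x y a c :
  x \in s -> y \in t -> x.2 = y.2 -> (y.1 <= h x.1)%E ->
  (forall z, z \in s /\ z.2 = x.2 -> (x.1 <= z.1)%E) ->
  (cnt s a c <= cnt t (h a) c)%N ->
  (cnt (rem x s) a c <= cnt (rem y t) (h a) c)%N.
Proof.
move=> xs yt xy yx xmin; rewrite /cnt.
rewrite (permP (perm_to_rem xs)) (permP (perm_to_rem yt))/= -xy.
have [/= xc|] := eqVneq x.2 c; last by rewrite !andbF.
have [xa|xa _] := boolP (x.1 <= a)%E.
  by rewrite (le_trans yx (h_homo xa))/= !add1n ltnS.
rewrite (@eq_in_count _ _ pred0) ?count_pred0// => z /mem_rem zs.
apply/negP => /andP[za /eqP zc]; case/negP: xa.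
by apply: le_trans za; apply: xmin; rewrite zc.
Qed.

Lemma count_gt0_ex s a c : (0 < cnt s a c)%N ->
  exists x, [/\ x \in s, (x.1 <= a)%E & x.2 = c].
Proof. by rewrite -has_count => /hasP[x xs /andP[xa /eqP]]; exists x. Qed.

(** For a fixed second coordinate, the entries of [s] and [t] with least first coordinate are
    paired. Counting at these values shows that each is at most [h] of the other, and removing the
    pair preserves the hypotheses. *)
Lemma sorted_matching s t :
  (forall a c, (cnt s a c <= cnt t (h a) c)%N) ->
  (forall a c, (cnt t a c <= cnt s (h a) c)%N) ->
  ms_matched (fun x y => [/\ (x.1 <= h y.1)%E, (y.1 <= h x.1)%E & x.2 = y.2])
    (multiset_of_seq s) (multiset_of_seq t).
Proof.
have cnt_mem u x : x \in u -> (0 < cnt u x.1 x.2)%N.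
  by move=> xu; rewrite -has_count; apply/hasP; exists x => //; rewrite lexx eqxx.
have [n] := ubnP (size s); elim: n => // n IHn in s t *; rewrite ltnS => sn st ts.
case: s => [|x0 s'] in sn st ts *.
  case: t ts {st} => [_|y t /(_ y.1 y.2)]; last by rewrite leqNgt cnt_mem// mem_head.
  by exists id => [|[]]//; exists id.
set s := _ :: s' in sn st ts *.
have [|x [[xs xE] xmin]] := @seq_argmin s x0.2.
  by exists x0; rewrite mem_head.
have [|y' [y't y'x y'E]] := @count_gt0_ex t (h x.1) x.2.
  exact: leq_trans (cnt_mem _ _ xs) (st _ _).
have [|y [[yt yE] ymin]] := @seq_argmin t x.2; first by exists y'.
have yx : (y.1 <= h x.1)%E by apply: le_trans y'x; exact: ymin.
have [|x' [x's x'y x'E]] := @count_gt0_ex s (h y.1) y.2.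
  exact: leq_trans (cnt_mem _ _ yt) (ts _ _).
have xy : (x.1 <= h y.1)%E.
  by apply: le_trans x'y; apply: xmin; rewrite x'E yE xE.
have rs : ms_matched
    (fun x y => [/\ (x.1 <= h y.1)%E, (y.1 <= h x.1)%E & x.2 = y.2])
    (multiset_of_seq (rem x s)) (multiset_of_seq (rem y t)).
  apply: IHn => [|a c|a c].
  - by rewrite size_rem//; exact: sn.
  - by apply: count_rem_le => // z; rewrite xE; exact: xmin.
  - by apply: count_rem_le => // z; rewrite yE; exact: ymin.
apply: ms_matched_eql (ms_perm (perm_to_rem xs)) _.
by apply: ms_matched_eqr (ms_perm (perm_to_rem yt)); exact: ms_matched_cons rs.
Qed.

End SortedMatching.

(** * Stability and verbose barcodes *)

Section ValuationStability.
Context {R : realType} {F : fieldType} {V : vectType F}.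

Lemma ms_map (S T : Type) (f : S -> T) (s : seq S) :
  ms_matched (fun x y => x = f y) (multiset_of_seq (map f s)) (multiset_of_seq s).
Proof.
exists (fun i : 'I_(size (map f s)) => cast_ord (size_map f s) i).
  by exists (cast_ord (esym (size_map f s))) => i; rewrite ?cast_ordK ?cast_ordKV.
move=> i; have x0 : S by case: (s) i => [[]|x].
rewrite /= (tnth_nth (f x0)) (tnth_nth x0)/= (nth_map x0)//.
by rewrite -(size_map f) ltn_ord.
Qed.

Lemma ms_matched_map (S T S' T' : Type) (f : S -> S') (g : T -> T')
    (r : S' -> T' -> Prop) (s : seq S) (t : seq T) :
  ms_matched r (multiset_of_seq (map f s)) (multiset_of_seq (map g t)) <->
  ms_matched (fun x y => r (f x) (g y)) (multiset_of_seq s) (multiset_of_seq t).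
Proof.
have mf := ms_map f s; have mg := ms_map g t; split=> st.
  have fs := ms_matched_sym (r2 := fun x y => y = f x) (fun _ _ e => e) mf.
  have sg : ms_matched (fun x y => r x (g y)) (multiset_of_seq (map f s))
      (multiset_of_seq t).
    by apply: ms_matched_trans st mg => x y z h <-.
  by apply: ms_matched_trans fs sg => x y z -> h.
have gt := ms_matched_sym (r2 := fun x y => y = g x) (fun _ _ e => e) mg.
have fst : ms_matched (fun x y => r x (g y)) (multiset_of_seq (map f s))
    (multiset_of_seq t).
  by apply: ms_matched_trans mf st => x y z -> h.
by apply: ms_matched_trans fst gt => x y z h ->.
Qed.

(** As [w] is common to both bases, the dimension count applies at each value of [w], in both
    directions, with [h] as the change of level. *)
Lemma orth_basis_matching1 (v v' w : V -> \bar R) (hv : valuation v)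
    (hv' : valuation v') (hw : valuation w) (U : {vspace V}) (b b' : seq V)
    (h : \bar R -> \bar R) :
  {homo h : x y / (x <= y)%E} ->
  basis_of U b -> orth v b -> orth w b ->
  basis_of U b' -> orth v' b' -> orth w b' ->
  (forall x, x \in U -> (v' x <= h (v x))%E) ->
  (forall x, x \in U -> (v x <= h (v' x))%E) ->
  ms_matched
    (fun x y => [/\ (v x <= h (v' y))%E, (v' y <= h (v x))%E & w x = w y])
    (multiset_of_seq b) (multiset_of_seq b').
Proof.
move=> h_homo bU ov ow bU' ov' ow' vh v'h.
apply/(ms_matched_map (fun x => (v x, w x)) (fun x => (v' x, w x))
  (fun x y => [/\ (x.1 <= h y.1)%E, (y.1 <= h x.1)%E & x.2 = y.2])).
apply: sorted_matching => // a c; rewrite !count_map.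
  apply: (@count_orth_basis_le _ _ _ v v' w hv' hw U b b' a (h a) c) => //.
  by move=> x xU xa; exact: le_trans (vh x xU) (h_homo _ _ xa).
apply: (@count_orth_basis_le _ _ _ v' v w hv hw U b' b a (h a) c) => //.
by move=> x xU xa; exact: le_trans (v'h x xU) (h_homo _ _ xa).
Qed.

(* The valuations are changed one at a time, through a basis orthogonal for
   [v'] and [w]. *)
Lemma orth_basis_matching (v v' w w' : V -> \bar R) (hv : valuation v)
    (hv' : valuation v') (hw : valuation w) (hw' : valuation w')
    (U : {vspace V}) (b b' : seq V) (h : \bar R -> \bar R) :
  {homo h : x y / (x <= y)%E} ->
  basis_of U b -> orth v b -> orth w b ->
  basis_of U b' -> orth v' b' -> orth w' b' ->
  (forall x, x \in U -> (v' x <= h (v x))%E) ->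
  (forall x, x \in U -> (v x <= h (v' x))%E) ->
  (forall x, x \in U -> (w' x <= h (w x))%E) ->
  (forall x, x \in U -> (w x <= h (w' x))%E) ->
  ms_matched
    (fun x y => ((v x <= h (v' y))%E /\ (v' y <= h (v x))%E) /\
                ((w x <= h (w' y))%E /\ (w' y <= h (w x))%E))
    (multiset_of_seq b) (multiset_of_seq b').
Proof.
move=> h_homo bU ov ow bU' ov' ow' vh v'h wh w'h.
have [b1 [b1U ov1 ow1]] := common_orth_basis hv' hw U.
apply: ms_matched_trans
  (orth_basis_matching1 hv hv' hw h_homo bU ov ow b1U ov1 ow1 vh v'h)
  (orth_basis_matching1 hw hw' hv' h_homo b1U ow1 ov1 bU' ow' ov' wh w'h).
by move=> x y z [? ? E1] [? ? E2]; rewrite -E2 E1.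
Qed.

End ValuationStability.

(** * Verbose barcodes from doubly orthogonal bases of cycles *)

Section VerboseBarcode.
Context {R : realType} {F : fieldType}.
Implicit Types C D : fcc R F.

Lemma bigmaxe_ord_recl n (P : pred 'I_n.+1) (f : 'I_n.+1 -> \bar R) :
  \big[maxe/-oo%E]_(i | P i) f i = maxe (if P ord0 then f ord0 else -oo%E)
    (\big[maxe/-oo%E]_(i < n | P (lift ord0 i)) f (lift ord0 i)).
Proof. by rewrite big_mkcond big_ord_recl; congr maxe; rewrite [RHS]big_mkcond. Qed.

(** Left to right, the head gets coefficient 1. Right to left, the head term is bounded by the sum,
    hence so is the remainder, and the ultrametric inequality becomes an equality. *)
Lemma orthogonal_chainsP C k (hv : valuation (@ell R F C k))
  (s : seq (chain C k)) : orthogonal_chains s <-> orth (@ell R F C k) s.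
Proof.
elim: s => [|x s IHs].
  split=> // _ lam; rewrite !big_ord0; exact: (valu0 hv).
split=> [os|os lam].
  have ext a (lam : 'I_(size s) -> F) :
      ell C (a *: x + \sum_(i < size s) lam i *: s`_i) =
      maxe (if a != 0 then ell C x else -oo%E)
        (\big[maxe/-oo%E]_(i < size s | lam i != 0) ell C s`_i).
    pose lam' (i : 'I_(size s).+1) := if unlift ord0 i is Some j then lam j else a.
    have := os lam'; rewrite bigmaxe_ord_recl !big_ord_recl/=.
    rewrite /lam' unlift_none; under eq_bigr do rewrite liftK.
    by under [X in _ = maxe _ X]eq_bigl do rewrite liftK.
  split=> [y ys|]; last first.
    apply/IHs => lam; have := ext 0 lam.
    by rewrite scale0r add0r eqxx/= max_r// leNye.
  rewrite -{2}[x]scale1r [y](coord_span (X := in_tuple s))// ext oner_eq0/=.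
  by rewrite le_max lexx.
have [h /IHs os'] := os.
rewrite bigmaxe_ord_recl !big_ord_recl/= -os'.
set y := \sum_(i < size s) _.
have ys : y \in << s>>%VS.
  by apply: memv_suml => i _; rewrite memvZ// memv_span// mem_nth// ltn_ord.
have -> : (if lam ord0 != 0 then ell C x else -oo%E) = ell C (lam ord0 *: x).
  by case: eqVneq => [->|/(valuZ hv) ->]//; rewrite scale0r (valu0 hv).
have ax := orth_consZ hv (lam ord0) os ys.
apply/eqP; rewrite eq_le (valuD hv)/= ge_max ax/=.
by rewrite -{1}[y](addKr (lam ord0 *: x)) (valuD_le hv)// (valuN hv).
Qed.

Definition rho C k (x : chain C k) : \bar R :=
  ereal_inf [set ell C y | y in [set y | bd C k y = x]].

Lemma rho_le C k y : (rho (bd C k y) <= ell C y)%E.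
Proof. by apply: ereal_inf_lbound; exists y. Qed.

Lemma ell_le_rho C k (x : chain C k) : (ell C x <= rho x)%E.
Proof. by apply: le_ereal_inf_tmp => _ [y <- <-]; exact: ell_bd. Qed.

(** Ensures that a finite infimum in [rho] is attained, so that boundaries have minimal
    preimages. *)
Definition finite_range C := forall k, exists s : seq (\bar R),
  forall x : chain C k, ell C x \in s.

Section FiniteRange.
Context (C : fcc R F) (hC : finite_range C).

Lemma ell_valuation k : valuation (@ell R F C k).
Proof.
by split=> [x|a x|x y|];
  [exact: ell_eqNy|exact: ellZ|exact: ellD|exact: hC].
Qed.

Lemma rho_attained k (x : chain C k) : (rho x < +oo)%E ->
  exists2 y, bd C k y = x & ell C y = rho x.
Proof.
move=> xoo; have [s sP] := hC k.+1.
have [|y [yx ymin]] := @finite_argmin _ _ (fun y => bd C k y = x) _ s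
    (fun y _ => sP y).
  by have [_ [y yx _] _] := ereal_inf_lt xoo; exists y.
exists y => //; apply/eqP; rewrite eq_le -{2}yx rho_le andbT.
by apply: le_ereal_inf_tmp => _ [z zx <-]; exact: ymin.
Qed.

Lemma rho_lty k (x : chain C k) : (rho x < +oo)%E <-> x \in boundaries C k.
Proof.
split=> [/rho_attained[y <- _]|/memv_imgP[y _ ->]].
  by rewrite memv_img// memvf.
exact: le_lt_trans (rho_le _) (ell_lty _).
Qed.

Lemma rho_valuation k : valuation (@rho C k).
Proof.
have rhoZ a (x : chain C k) : (rho (a *: x) <= rho x)%E.
  apply: le_ereal_inf_tmp => _ [y <- <-]; rewrite -linearZ.
  exact: le_trans (rho_le _) (valuZ_le (ell_valuation _) _ _).
split=> [x|a x a0|x y|].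
- split=> [xNy|->]; last first.
    apply/eqP; rewrite -leeNy_eq -(linear0 (bd C k)).
    by apply: le_trans (rho_le _) _; rewrite (valu0 (ell_valuation _)).
  by apply/(valu_eqNy (ell_valuation _))/eqP; rewrite -leeNy_eq -xNy ell_le_rho.
- apply/eqP; rewrite eq_le rhoZ/=.
  by have := rhoZ a^-1 (a *: x); rewrite scalerA mulVf// scale1r.
- have [->|xoo] := eqVneq (rho x) +oo%E; first by rewrite maxye leey.
  have [->|yoo] := eqVneq (rho y) +oo%E; first by rewrite maxey leey.
  move: xoo yoo; rewrite -!ltey => /rho_attained[x' <- <-] /rho_attained[y' <- <-].
  by rewrite -linearD; apply: le_trans (rho_le _) (ellD _ _).
- have [s sP] := hC k.+1; exists (+oo%E :: s) => x; rewrite inE.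
  have [//|] := eqVneq (rho x) +oo%E; rewrite -ltey => /rho_attained[y _ <-].
  exact: sP.
Qed.

(** The preimages of [bd C k u] are the sums [u + z] with [z] in the kernel, so [u] is a minimal
    one. *)
Lemma rho_bd k (u : chain C k.+1) :
  (forall z, z \in lker (bd C k) -> (ell C u <= ell C (u + z)%R)%E) ->
  rho (bd C k u) = ell C u.
Proof.
move=> uz; apply/eqP; rewrite eq_le rho_le/=.
apply: le_ereal_inf_tmp => _ [z zu <-].
by rewrite -[z](subrK u) addrC uz// memv_ker linearB/= zu subrr.
Qed.

(** By [rho_bd], the differential carries [ell] to [rho] on the span of [s]. *)
Lemma orth_rho_map k (s : seq (chain C k.+1)) : orth (@ell R F C k.+1) s ->
  (forall u z, u \in << s>>%VS -> z \in lker (bd C k) ->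
    (ell C u <= ell C (u + z)%R)%E) ->
  orth (@rho C k) (map (bd C k) s).
Proof.
elim: s => //= x s IHs [h os] sz; split; last first.
  apply: IHs => // u z us; apply: sz.
  by rewrite span_cons -[u]add0r memv_add// mem0v.
move=> y; rewrite -limg_span => /memv_imgP[u us ->].
rewrite -linearD !rho_bd; first exact: h.
  by move=> z; apply: sz; rewrite span_cons memv_add// memv_line.
by move=> z; apply: sz; rewrite span_cons -[x]addr0 memv_add ?mem0v// addr0 memv_line.
Qed.

(** A nonzero vector of the span is no boundary, so its [rho] is [+oo]. *)
Lemma orth_rho_compl k (s : seq (chain C k)) : free s ->
  (forall x, x \in << s>>%VS -> x \in boundaries C k -> x = 0) ->
  orth (@rho C k) s.
Proof.
elim: s => //= x s IHs; rewrite free_cons => /andP[xs fs] sB; split; last first.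
  by apply: IHs => // u us; apply: sB; rewrite span_cons -[u]add0r memv_add// mem0v.
move=> y ys.
have [|h] := ltP (rho (x + y)%R) +oo%E; last by apply: le_trans h; rewrite leey.
move=> /(rho_lty _)/sB xy0; move: xs; rewrite -[x](addrK y) xy0 ?sub0r ?memvN ?ys//.
by rewrite span_cons memv_add// memv_line.
Qed.

(** Each term of a combination of minimal lifts is bounded by [rho] of the boundary of the
    combination, by orthogonality; so combinations are again minimal lifts. *)
Lemma orth_ell_lift k (s : seq (chain C k.+1)) :
  (forall y, y \in s -> ell C y = rho (bd C k y)) ->
  orth (@rho C k) (map (bd C k) s) ->
  orth (@ell R F C k.+1) s /\
  forall u, u \in << s>>%VS -> ell C u = rho (bd C k u).
Proof.
elim: s => [|x s IHs] sE /=.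
  move=> _; split=> // u; rewrite span_nil memv0 => /eqP ->.
  by rewrite linear0 (valu0 (ell_valuation _)) (valu0 (rho_valuation _)).
move=> os; have [h os'] := os.
have [|//|os'' sE'] := IHs; first by move=> y ys; apply: sE; rewrite inE ys orbT.
have xE : ell C x = rho (bd C k x) by apply: sE; rewrite mem_head.
split=> [|u].
  split=> // u us; rewrite xE; apply: le_trans (h (bd C k u) _) _.
    by rewrite -limg_span memv_img.
  by rewrite -linearD rho_le.
rewrite span_cons => /memv_addP[_ /vlineP[a ->] [y ys ->]].
apply/eqP; rewrite eq_le rho_le andbT linearD linearZ/=.
have ys' : bd C k y \in << map (bd C k) s>>%VS by rewrite -limg_span memv_img.
have ax := orth_consZ (rho_valuation k) a os ys'.
apply: (valuD_le (ell_valuation _)).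
  apply: le_trans ax; have [->|a0] := eqVneq a 0.
    by rewrite scale0r (valu0 (ell_valuation _)) leNye.
  by rewrite (valuZ (ell_valuation _))// (valuZ (rho_valuation _))// xE.
rewrite sE'// -{1}[bd C k y](addKr (a *: bd C k x)).
by apply: (valuD_le (rho_valuation _)); rewrite ?(valuN (rho_valuation _)).
Qed.

Lemma dim_boundaries_le k : (\dim (boundaries C k) <= \dim {: chain C k.+1})%N.
Proof. by rewrite -(limg_ker_dim (bd C k) fullv) leq_addl. Qed.

(** The last [ys] span the kernel, so orthogonality makes the first [r] of them minimal lifts, and
    their [ell] is [rho] of the matching [xs]. The remaining [xs] are independent modulo boundaries,
    so their [rho] is infinite. *)
Lemma compatible_orth k ys xs : @compatible_bases R F C k ys xs ->
  [/\ orth (@ell R F C k) xs, orth (@rho C k) xs &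
    barcode_of_bases ys xs = [seq (ell C x, rho x) | x <- xs]].
Proof.
move=> [/(orthogonal_chainsP (ell_valuation _)) oy
  /(orthogonal_chainsP (ell_valuation _)) ox by_ bx bK bB bdE].
set r := \dim (boundaries C k) in bK bB bdE *.
have rxs : (r <= size xs)%N.
  have := size_basis (X := in_tuple (take r xs)) bB.
  by rewrite -/r size_take; case: ltnP => [/ltnW//|_ <-].
have rys : (r <= size ys)%N.
  by rewrite -(size_basis (X := in_tuple ys) by_) dim_boundaries_le.
have bdys : map (bd C k) (take r ys) = take r xs.
  apply: (@eq_from_nth _ 0); first by rewrite size_map !size_takel.
  move=> i; rewrite size_map size_takel// => ir.
  by rewrite (nth_map 0) ?size_takel// !nth_take// bdE.
have /(orth_catP (ell_valuation _))[oy1 _ oy12] :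
    orth (@ell R F C k.+1) (take r ys ++ drop r ys) by rewrite cat_take_drop.
have yz u z : u \in << take r ys>>%VS -> z \in lker (bd C k) ->
    (ell C u <= ell C (u + z)%R)%E.
  by move=> us zK; apply: oy12; rewrite ?(span_basis bK).
have /and3P[_ free2 /directv_addP cap0] :
  [&& free (take r xs), free (drop r xs)
    & directv (<< take r xs>> + << drop r xs>>)].
  by rewrite -cat_free cat_take_drop (basis_free bx).
have dropB x : x \in << drop r xs>>%VS -> x \in boundaries C k -> x = 0.
  move=> xd xB; apply/eqP; rewrite -memv0 -cap0 memv_cap xd andbT.
  by rewrite (span_basis bB).
have orho : orth (@rho C k) xs.
  rewrite -(cat_take_drop r xs); apply: orth_cat.
  - by rewrite -bdys; exact: orth_rho_map.
  - exact: orth_rho_compl.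
  (* Here [x] is a boundary and [y], if nonzero, is not; so [x + y] is no boundary and its [rho] is
     [+oo]. *)
  - move=> x y; rewrite (span_basis bB) => xB yd.
    have [->|y0] := eqVneq y 0; first by rewrite addr0.
    have [|h] := ltP (rho (x + y)%R) +oo%E; last by apply: le_trans h; rewrite leey.
    move=> /(rho_lty _) xyB; case/eqP: y0; apply: dropB => //.
    by rewrite -[y](addKr x) memvD// memvN.
split=> //.
rewrite /barcode_of_bases -/r -{3}(cat_take_drop r xs) map_cat; congr (_ ++ _).
  apply: (@eq_from_nth _ (0, 0)%E).
    by rewrite !size_map size_iota size_takel.
  move=> i; rewrite size_map size_iota => ir.
  rewrite (nth_map 0%N) ?size_iota// (nth_map 0) ?size_takel// nth_iota// add0n.
  rewrite nth_take// -bdE// rho_bd// => z; apply: yz.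
  by rewrite memv_span// -(nth_take 0 ir) mem_nth// size_takel.
apply/eq_in_map => x xd; congr (_, _); apply/esym/eqP.
rewrite -leye_eq leNgt; apply/negP => /(rho_lty _) xB.
have x0 : x != 0 by rewrite (free_not0 free2).
by case/eqP: x0; apply: dropB => //; rewrite memv_span.
Qed.

Lemma boundaries_sub_cycles k : (boundaries C k <= cycles C k)%VS.
Proof.
case: k => [|k]; first exact: subvf.
by apply/subvP => _ /memv_imgP[y _ ->]; rewrite memv_ker bd_bd.
Qed.

(** In a basis of the cycles orthogonal for [ell] and [rho], the vectors of finite [rho] form a
    basis of the boundaries. Their minimal lifts, followed by an orthogonal basis of the kernel,
    give the basis one degree up. *)
Lemma compatible_bases_exist k : exists ys xs, @compatible_bases R F C k ys xs.
Proof.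
have [b [bZ oe orh]] :=
  common_orth_basis (ell_valuation k) (rho_valuation k) (cycles C k).
pose p x := (@rho C k x < +oo)%E.
pose xs1 := seq.filter p b; pose xs2 := seq.filter (predC p) b.
have bB : basis_of (boundaries C k) xs1.
  rewrite /basis_of (filter_free _ (basis_free bZ)) andbT eqEsubv.
  apply/andP; split.
    by apply/span_subvP => x; rewrite mem_filter => /andP[/(rho_lty _)].
  apply/subvP => x xB; have xoo : (rho x < +oo)%E by apply/rho_lty.
  have xb : x \in << b>>%VS.
    by rewrite (span_basis bZ); exact: (subvP (boundaries_sub_cycles _)).
  (* With level [+oo] for [ell] and [rho x] for [rho], only basis vectors of finite [rho] occur in
     the boundary [x]. *)
  have /= := orth2_span_filter (ell_valuation k) (rho_valuation k) oe orh xb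
    (leey _) (lexx _).
  apply: subvP; apply: sub_span => y; rewrite !mem_filter.
  by move=> /andP[/andP[_ yx] ->]; rewrite /p (le_lt_trans yx xoo).
have sxs1 : size xs1 = \dim (boundaries C k).
  by rewrite (size_basis (X := in_tuple xs1) bB).
pose lift x := xget 0 [set y | bd C k y = x /\ ell C y = rho x].
have liftP x : x \in xs1 -> bd C k (lift x) = x /\ ell C (lift x) = rho x.
  rewrite mem_filter => /andP[/rho_attained[y yx ye] _].
  exact: (@xgetPex _ 0 [set y | bd C k y = x /\ ell C y = rho x]
    (ex_intro _ y (conj yx ye))).
pose ys1 := map lift xs1.
have bdys1 : map (bd C k) ys1 = xs1.
  rewrite -map_comp -[RHS]map_id; apply/eq_in_map => x /liftP[].
  by [].
have [|//|oy1 y1E] := @orth_ell_lift k ys1.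
- by move=> _ /mapP[x /liftP[e1 e2] ->]; rewrite e1.
- by rewrite bdys1; exact: orth_filter.
have [kb [bK ok _]] :=
  common_orth_basis (ell_valuation k.+1) (ell_valuation k.+1) (lker (bd C k)).
have sys1 : size ys1 = \dim (boundaries C k) by rewrite size_map.
exists (ys1 ++ kb), (xs1 ++ xs2); split.
(* For [u] in the span of the lifts and [z] in the kernel, [ell u = rho (bd u) = rho (bd (u + z)) <=
   ell (u + z)]. *)
- apply/(orthogonal_chainsP (ell_valuation _)); apply: orth_cat => // u z us zK.
  rewrite y1E//; apply: le_trans (rho_le _); rewrite linearD/=.
  move: zK; rewrite (span_basis bK) memv_ker => /eqP ->.
  by rewrite addr0.
- apply/(orthogonal_chainsP (ell_valuation _)); apply: orth_cat.
  + exact: orth_filter.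
  + exact: orth_filter.
  + by move=> x y; apply: orth_filter_split => //; exact: ell_valuation.
- rewrite basisEdim size_cat sys1 addnC.
  rewrite -(limg_ker_dim (bd C k) fullv) capfv (size_basis (X := in_tuple kb) bK).
  rewrite leqnn andbT; apply/subvP => y _.
  have : bd C k y \in << xs1>>%VS by rewrite (span_basis bB) memv_img// memvf.
  rewrite -bdys1 -limg_span => /memv_imgP[u us yu].
  rewrite span_cat (span_basis bK) -[y](subrK u) addrC memv_add//.
  by rewrite memv_ker linearB/= yu subrr.
- by rewrite (perm_basis _ (permEl (perm_filterC p b))).
- by rewrite -sys1 drop_size_cat.
- by rewrite -sxs1 take_size_cat.
- move=> i ir; rewrite !nth_cat sys1 sxs1 ir -[in RHS]bdys1.
  by rewrite (nth_map 0 _ (bd C k)) ?sys1.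
Qed.

(** The bases behind [verbose_barcode] need not be those constructed above: their existence only
    excludes the default [[::]], and [compatible_orth] applies to whichever pair is selected. *)
Lemma verbose_barcodeE k : exists xs : seq (chain C k),
  [/\ basis_of (cycles C k) xs, orth (@ell R F C k) xs, orth (@rho C k) xs &
    verbose_barcode C k = [seq (ell C x, rho x) | x <- xs]].
Proof.
have [ys [xs h]] := compatible_bases_exist k.
have [ys' [xs' [h' ->]]] : exists ys xs, compatible_bases ys xs /\
    verbose_barcode C k = @barcode_of_bases R F C k ys xs.
  apply: (@xgetPex _ [::] [set b | exists ys xs,
    @compatible_bases R F C k ys xs /\ b = barcode_of_bases ys xs]).
  by exists (barcode_of_bases ys xs), ys, xs.
by exists xs'; have [? ? ->] := compatible_orth h'; split=> //; case: h'.
Qed.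

End FiniteRange.
End VerboseBarcode.

(** * Comparing the barcodes of two complexes *)

Section BarcodeComparison.
Context {R : realType} {F : fieldType}.
Implicit Types C D : fcc R F.

Lemma valuation_comp (V W : vectType F) (f : 'Hom(V, W)) (v : W -> \bar R) :
  injective f -> valuation v -> valuation (v \o f).
Proof.
move=> finj hv; split=> [x|a x a0|x y|] /=.
- rewrite (valu_eqNy hv); split=> [/eqP|->]; last by rewrite linear0.
  by rewrite -(linear0 f) (inj_eq finj) => /eqP.
- by rewrite linearZ (valuZ hv).
- by rewrite linearD (valuD hv).
- by have [s sP] := valu_fin hv; exists s => x; exact: sP.
Qed.

Lemma orth_map (V W : vectType F) (f : 'Hom(V, W)) (v : V -> \bar R)
    (w : W -> \bar R) (s : seq V) :
  (forall x, x \in << s>>%VS -> w (f x) = v x) -> orth v s ->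
  orth w (map f s).
Proof.
elim: s => //= x s IHs wv [h os]; split; last first.
  apply: IHs => // y ys; apply: wv.
  by rewrite span_cons -[y]add0r memv_add// mem0v.
move=> y; rewrite -limg_span => /memv_imgP[u us ->].
rewrite -linearD !wv; first exact: h.
  by rewrite span_cons memv_add// memv_line.
by rewrite memv_span// mem_head.
Qed.

(** Stability with [h] the identity and unchanged valuations gives inequalities both ways, hence
    equal bars. *)
Lemma barcode_unique C (hC : finite_range C) k (xs : seq (chain C k)) :
  basis_of (cycles C k) xs -> orth (@ell R F C k) xs -> orth (@rho R F C k) xs ->
  ms_matched eq (multiset_of_seq (verbose_barcode C k))
    (multiset_of_seq [seq (ell C x, rho x) | x <- xs]).
Proof.
move=> bx ox ox'; have [ys [by_ oy oy' ->]] := verbose_barcodeE hC k.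
apply/ms_matched_map.
have := orth_basis_matching (ell_valuation hC k) (ell_valuation hC k)
  (rho_valuation hC k) (rho_valuation hC k) (h := id) (fun _ _ h => h)
  by_ oy oy' bx ox ox' (fun _ _ => lexx _) (fun _ _ => lexx _)
  (fun _ _ => lexx _) (fun _ _ => lexx _).
apply: ms_matched_impl => x y [[xy yx] [xy' yx']].
by congr (_, _); apply: le_anti; [rewrite xy yx|rewrite xy' yx'].
Qed.

Section ChainMaps.
Context C D (f : forall k, 'Hom(chain C k, chain D k)).
Hypothesis f_bd : forall k x, bd D k (f k.+1 x) = f k (bd C k x).

Lemma chain_map_cycles k x : x \in cycles C k -> f k x \in cycles D k.
Proof.
case: k x => [|k] x; first by move=> _; exact: memvf.
by rewrite !memv_ker f_bd => /eqP ->; rewrite linear0.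
Qed.

(** A chain map sends a minimal preimage of [x] to a preimage of [f k x]. *)
Lemma rho_chain_map (h : \bar R -> \bar R) k x : finite_range C ->
  h +oo%E = +oo%E ->
  (forall y : chain C k.+1, (ell D (f k.+1 y) <= h (ell C y))%E) ->
  (rho (f k x) <= h (rho x))%E.
Proof.
move=> hC hoo fh; have [->|] := eqVneq (rho x) +oo%E; first by rewrite hoo leey.
rewrite -ltey => /(rho_attained hC)[y <- <-]; rewrite -f_bd.
exact: le_trans (rho_le _) (fh y).
Qed.

End ChainMaps.

(** The basis for [D] is transported to [C] by [g], and the valuations of [D] are composed with [f],
    so that two bases of one space are compared. *)
Lemma iso_barcode_matching C D (hC : finite_range C) (hD : finite_range D)
    (f : forall k, 'Hom(chain C k, chain D k))
    (g : forall k, 'Hom(chain D k, chain C k)) (h : \bar R -> \bar R) k :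
  {homo h : x y / (x <= y)%E} -> h +oo%E = +oo%E ->
  (forall k x, bd D k (f k.+1 x) = f k (bd C k x)) ->
  (forall k x, bd C k (g k.+1 x) = g k (bd D k x)) ->
  (forall k, cancel (f k) (g k)) -> (forall k, cancel (g k) (f k)) ->
  (forall k x, (ell D (f k x) <= h (ell C x))%E) ->
  (forall k x, (ell C (g k x) <= h (ell D x))%E) ->
  ms_matched (fun x y : \bar R * \bar R =>
      ((x.1 <= h y.1)%E /\ (y.1 <= h x.1)%E) /\
      ((x.2 <= h y.2)%E /\ (y.2 <= h x.2)%E))
    (multiset_of_seq (verbose_barcode C k))
    (multiset_of_seq (verbose_barcode D k)).
Proof.
move=> h_homo hoo fbd gbd fg gf fh gh.
have [xs [bx ox ox' ->]] := verbose_barcodeE hC k.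
have [ys [by_ oy oy' ->]] := verbose_barcodeE hD k.
have finj := can_inj (fg k).
have gker : (cycles D k :&: lker (g k) = 0)%VS.
  by have /eqP -> := introT lker0P (can_inj (gf k)); rewrite capv0.
have gZ : (g k @: cycles D k)%VS = cycles C k.
  apply/vspaceP => x; apply/idP/idP => [/memv_imgP[y yZ ->]|xZ].
    exact: chain_map_cycles.
  by apply/memv_imgP; exists (f k x); [exact: chain_map_cycles|rewrite fg].
have bgy := limg_basis_of gker by_; rewrite gZ in bgy.
have := orth_basis_matching (ell_valuation hC k)
  (valuation_comp finj (ell_valuation hD k)) (rho_valuation hC k)
  (valuation_comp finj (rho_valuation hD k)) h_homo bx ox ox' bgy.
have og (v : chain D k -> \bar R) : orth v ys -> orth (v \o f k) (map (g k) ys).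
  by apply: (orth_map (f := g k)) => y _ /=; rewrite gf.
move=> /(_ (og _ oy) (og _ oy')) m; apply/ms_matched_map.
have {m} := m (fun x _ => fh k x).
have e1 x : x \in cycles C k -> (ell C x <= h (ell D (f k x)))%E.
  by move=> _; rewrite -{1}[x](fg k).
have e2 x : x \in cycles C k -> (rho (f k x) <= h (rho x))%E.
  by move=> _; apply: (rho_chain_map fbd).
have e3 x : x \in cycles C k -> (rho x <= h (rho (f k x)))%E.
  by move=> _; rewrite -{1}[x](fg k); apply: (rho_chain_map gbd).
move=> /(_ e1 e2 e3) m.
have -> : ys = map (f k) (map (g k) ys).
  by rewrite -map_comp -[LHS]map_id; apply: eq_map => y /=; rewrite gf.
have mf := ms_matched_sym (r2 := fun x y => y = f k x) (fun _ _ e => e)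
  (ms_map (f k) (map (g k) ys)).
by apply: ms_matched_trans m mf => x y z m ->.
Qed.

(** From level [M] on the sublevels are everything, so the interleaving maps there are inverse
    isomorphisms. The bound at [x] comes from the map at level [ell x], which has the same value at
    [x] by naturality. *)
Lemma interleaved_iso C D (M delta : R) :
  (forall k (x : chain C k), (ell C x <= M%:E)%E) ->
  (forall k (x : chain D k), (ell D x <= M%:E)%E) ->
  0 <= delta -> interleaved C D delta ->
  exists (f : forall k, 'Hom(chain C k, chain D k))
    (g : forall k, 'Hom(chain D k, chain C k)),
    [/\ (forall k x, bd D k (f k.+1 x) = f k (bd C k x)) /\
        (forall k x, bd C k (g k.+1 x) = g k (bd D k x)),
      forall k, cancel (f k) (g k), forall k, cancel (g k) (f k),
      forall k x, (ell D (f k x) <= ell C x + delta%:E)%E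
    & forall k x, (ell C (g k x) <= ell D x + delta%:E)%E].
Proof.
move=> CM DM d0 [f [g [sf sg gf fg]]].
have total (A B : fcc R F) (p : R -> forall k, chain A k -> chain B k) :
    (forall k (x : chain A k), (ell A x <= M%:E)%E) -> shift_map delta p ->
    exists P : forall k, 'Hom(chain A k, chain B k),
    [/\ forall t k x, M <= t -> p t k x = P k x,
        forall k x, bd B k (P k.+1 x) = P k (bd A k x)
      & forall k x, (ell B (P k x) <= ell A x + delta%:E)%E].
  move=> AM [psub plin pbd pincl].
  have lin k : linear (p M k) by move=> a x y; apply: plin; exact: AM.
  pose Lk k : {linear chain A k -> chain B k} := HB.pack (p M k)
    (GRing.isLinear.Build F (chain A k) (chain B k) _ (p M k) (lin k)).
  exists (fun k => linfun (Lk k)); split=> [t k x Mt|k x|k x].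
  - by rewrite lfunE/=; apply: pincl => //; exact: AM.
  - by rewrite !lfunE/=; apply: pbd; exact: AM.
  (* The zero chain has value [-oo], which is no real level. *)
  - rewrite lfunE/=; have [->|x0] := eqVneq x 0.
      by rewrite -[p M k]/(Lk k : _ -> _) linear0 (proj2 (ell_eqNy _)) ?leNye.
    have xNy : ell A x != -oo%E by apply: contra x0 => /eqP/(ell_eqNy x)/eqP.
    have := AM k x; case E : (ell A x) xNy => [t| |]// _; rewrite lee_fin => tM.
    have xt : sublevel t x by rewrite /sublevel/= E.
    by rewrite (pincl t M k x)//; exact: psub.
have [P [Pf Pbd Pell]] := total _ _ _ CM sf.
have [Q [Qg Qbd Qell]] := total _ _ _ DM sg.
have Md : M <= M + delta by rewrite lerDl.
exists P, Q; split=> // k x.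
  by rewrite -(Pf M)// -(Qg (M + delta))// gf//; exact: CM.
by rewrite -(Qg M)// -(Pf (M + delta))// fg//; exact: DM.
Qed.

(** The cycles of [C] split into the image of those of [D] and the cycles killed by [pi],
    orthogonally because [pi] increases neither [ell] nor [rho]. On the image both values are those
    in [D]; a cycle killed by [pi] bounds a chain of no larger [ell], so its bar is diagonal. *)
Lemma retract_barcode C D (hC : finite_range C) (hD : finite_range D)
    (s : forall k, 'Hom(chain D k, chain C k))
    (pi : forall k, 'Hom(chain C k, chain C k)) k :
  (forall k x, bd C k (s k.+1 x) = s k (bd D k x)) ->
  (forall k x, ell C (s k x) = ell D x) ->
  (forall k x, bd C k (pi k.+1 x) = pi k (bd C k x)) ->
  (forall k x, (ell C (pi k x) <= ell C x)%E) ->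
  (forall k x, exists y, pi k x = s k y) ->
  (forall k y, pi k (s k y) = s k y) ->
  (forall x, x \in cycles C k ->
    exists2 u, bd C k u = x - pi k x & (ell C u <= ell C x)%E) ->
  exists2 ws : seq (chain C k), {in ws, forall w, w != 0} &
    ms_matched eq (multiset_of_seq (verbose_barcode C k))
      (multiset_of_seq (verbose_barcode D k ++
        [seq (ell C w, ell C w) | w <- ws])).
Proof.
move=> sbd sell pibd piell pis spi hom.
have [xs [bx ox ox' ->]] := verbose_barcodeE hD k.
have sinj k' : injective (s k').
  move=> x y exy; apply/eqP; rewrite -subr_eq0; apply/eqP/(ell_eqNy (f := D)).
  by rewrite -sell linearB/= exy subrr; apply/(ell_eqNy (f := C)).
pose K := (cycles C k :&: lker (pi k))%VS.
have [ws [bw ow ow']] := common_orth_basis (ell_valuation hC k) (rho_valuation hC k) K.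
exists ws; first by move=> w; exact: basis_not0 bw.
have rhopi x : (rho (pi k x) <= rho x)%E.
  exact: (rho_chain_map pibd (h := id)).
(* A preimage [y] of [s x] is replaced by [pi y = s y']; then [y'] is a preimage of [x] of no larger
   value. *)
have rhos x : rho (s k x) = rho x.
  apply/eqP; rewrite eq_le (rho_chain_map sbd (h := id))//=; last first.
    by move=> y; rewrite sell.
  have [->|] := eqVneq (rho (s k x)) +oo%E; first by rewrite leey.
  rewrite -ltey => /(rho_attained hC)[y yx <-].
  have [y' piy] := pis _ y.
  have bdy' : bd D k y' = x by apply: (sinj k); rewrite -sbd -piy pibd yx spi.
  by rewrite -bdy'; apply: le_trans (rho_le _) _; rewrite -sell -piy.
have sE : << map (s k) xs>>%VS = (s k @: cycles D k)%VS.
  by rewrite -limg_span (span_basis bx).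
have smem x : x \in cycles C k -> pi k x \in (s k @: cycles D k)%VS.
  move=> xZ; have [y piy] := pis _ x; rewrite piy memv_img//.
  have : pi k x \in cycles C k by exact: chain_map_cycles.
  rewrite piy; case: (k) y {piy xZ x} => [|k'] y; first by move=> _; exact: memvf.
  by rewrite !memv_ker sbd -{1}(linear0 (s k')) (inj_eq (sinj k')).
have sZ : (s k @: cycles D k <= cycles C k)%VS.
  by apply/subvP => _ /memv_imgP[y yZ ->]; exact: chain_map_cycles.
(* Applying [pi] to [x + y] gives back [x], and [pi] does not increase [v]. *)
have split_ (v : chain C k -> \bar R) (hv : valuation v) :
    (forall x, (v (pi k x) <= v x)%E) ->
    forall x y, x \in << map (s k) xs>>%VS -> y \in << ws>>%VS ->
    (v x <= v (x + y)%R)%E.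
  move=> vpi x y; rewrite sE (span_basis bw) => /memv_imgP[u _ ->].
  rewrite memv_cap memv_ker => /andP[_ /eqP piy].
  by apply: le_trans (vpi _); rewrite linearD/= piy addr0 spi.
have xsws : basis_of (cycles C k) (map (s k) xs ++ ws).
  rewrite /basis_of span_cat sE (span_basis bw) eqEsubv subv_add sZ capvSl/=.
  apply/andP; split.
    apply/subvP => x xZ; rewrite -[x](subrK (pi k x)) addrC memv_add ?smem//.
    rewrite memv_cap memvB ?(chain_map_cycles pibd)//= memv_ker linearB/=.
    by have [y ->] := pis _ x; rewrite spi subrr.
  rewrite cat_free (basis_free bw).
  have -> /= : free (map (s k) xs).
    have sker : (cycles D k :&: lker (s k) = 0)%VS.
      by have /eqP -> := introT lker0P (sinj k); rewrite capv0.
    exact: basis_free (limg_basis_of sker bx).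
  apply/directv_addP/eqP; rewrite sE (span_basis bw) -subv0.
  apply/subvP => x /memv_capP[/memv_imgP[u _ ->]].
  by rewrite memv_cap memv_ker spi memv0 => /andP[_].
apply: ms_matched_eql (barcode_unique hC xsws _ _) _.
- apply: orth_cat => //; last exact: (split_ _ (ell_valuation hC k) (piell k)).
  by apply: orth_map ox.
- apply: orth_cat => //; last exact: (split_ _ (rho_valuation hC k) rhopi).
  by apply: orth_map ox'.
rewrite map_cat -map_comp; set a := map _ xs; set b := map _ ws.
set a' := map _ xs; set b' := map _ ws.
have -> : a = a' by apply: eq_map => x /=; rewrite sell rhos.
have -> : b = b'; last exact: ms_matched_refl.
apply/eq_in_map => w /(basis_mem bw); rewrite memv_cap memv_ker => /andP[wZ /eqP piw].
have [u uw ul] := hom w wZ; rewrite piw subr0 in uw.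
by congr (_, _); apply/le_anti; rewrite ell_le_rho andbT -uw (le_trans (rho_le _))// uw.
Qed.

End BarcodeComparison.

(** * Vietoris-Rips complexes *)

Section Diameter.
Context {R : realType} {T : finType} (d : pseudometric R T).
Implicit Types s t : {set T}.

Lemma diam_leP s e :
  reflect (0 <= e /\ {in s &, forall u v, d u v <= e}) (diam d s <= e).
Proof.
apply: (iffP (bigmax_leP _ _ _ _)) => [[e0 h]|[e0 h]]; split=> // u.
  by move=> v us vs; have /bigmax_leP[_ /(_ v vs)] := h u us.
by move=> us; apply/bigmax_leP; split=> // v vs; exact: h.
Qed.

Lemma diam_ge0 s : 0 <= diam d s.
Proof. exact: bigmax_ge_id. Qed.

Lemma le_diam s u v : u \in s -> v \in s -> d u v <= diam d s.
Proof. by have /diam_leP[_] := lexx (diam d s); apply. Qed.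

End Diameter.

Lemma diam_imset (R : realType) (T T' : finType) (d : pseudometric R T)
    (d' : pseudometric R T') (f : T' -> T) (s : {set T'}) :
  (forall u v, d (f u) (f v) = d' u v) -> diam d (f @: s) = diam d' s.
Proof.
move=> df; apply/eqP; rewrite eq_le; apply/andP; split; apply/diam_leP.
  split=> [|_ _ /imsetP[u us ->] /imsetP[v vs ->]]; first exact: diam_ge0.
  by rewrite df le_diam.
split=> [|u v us vs]; first exact: diam_ge0.
by rewrite -df le_diam// imset_f.
Qed.

Lemma diam_le_add (R : realType) (T : finType) (d d' : pseudometric R T)
    (delta : R) (s : {set T}) : 0 <= delta ->
  (forall u v, d u v <= d' u v + delta) -> diam d s <= diam d' s + delta.
Proof.
move=> d0 dd'; apply/diam_leP; split; first by rewrite addr_ge0// diam_ge0.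
by move=> u v us vs; apply: le_trans (dd' _ _) _; rewrite lerD2r le_diam.
Qed.

Section VRComplex.
Context {R : realType} (F : fieldType) {T : finType} (d : pseudometric R T).

Lemma VR_finite_range : finite_range (VR F d).
Proof.
move=> k; exists (-oo%E :: [seq (diam d (val s))%:E | s : @simplex T k]) => c.
rewrite /= /vr_ell; elim/big_ind: _ => [|x y xs ys|s _].
- by rewrite mem_head.
- by rewrite maxEle; case: ifP.
- by rewrite inE; apply/orP; right; apply: map_f; rewrite mem_enum.
Qed.

Lemma VR_ell_le k (c : chain (VR F d) k) :
  (ell (VR F d) c <= (diam d (finset.setTfor T))%:E)%E.
Proof. by apply/vr_ell_leP => s _; rewrite lee_fin diamS// finset.subsetT. Qed.

Lemma VR_ell_fin k (c : chain (VR F d) k) : c != 0 ->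
  exists2 r, 0 <= r & ell (VR F d) c = r%:E.
Proof.
move=> c0; have cNy : ell (VR F d) c != -oo%E.
  by apply: contra c0 => /eqP/(ell_eqNy (f := VR F d))/eqP.
have /existsP[s cs] : [exists s, (c : vr_chain F k) s != 0].
  apply: contraNT c0; rewrite negb_exists => /forallP c0.
  by apply/eqP/ffunP => s; rewrite ffunE; apply/eqP/negPn.
have := le_vr_ell d cs; have := VR_ell_le c; rewrite -[vr_ell d c]/(ell (VR F d) c).
case: (ell _ _) cNy => // r _ _; rewrite lee_fin => sr; exists r => //.
exact: le_trans (diam_ge0 _ _) sr.
Qed.

(* This is 0 on sets of the wrong cardinality. *)
Definition coef k (c : vr_chain F k) (s : {set T}) : F :=
  if insub s is Some t then c (t : simplex k) else 0.

Lemma coef_val k (c : vr_chain F k) (s : simplex k) : coef c (val s) = c s.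
Proof. by rewrite /coef valK. Qed.

Lemma coef_out k (c : vr_chain F k) (s : {set T}) : #|s| != k.+1 -> coef c s = 0.
Proof. by move=> sk; rewrite /coef insubN. Qed.

Lemma coef_ffun k (f : {set T} -> F) s :
  coef [ffun t : simplex k => f (val t)] s = if #|s| == k.+1 then f s else 0.
Proof.
rewrite /coef; case: insubP => [t sk ts|/negPf -> //].
by rewrite ffunE ts sk.
Qed.

Lemma coef_neq0 k (c : vr_chain F k) (s : {set T}) : coef c s != 0 ->
  (#|s| == k.+1) * ((diam d s)%:E <= vr_ell d c)%E.
Proof.
rewrite /coef; case: insubP => [t sk ts cs|]; last by rewrite eqxx.
by split=> //; rewrite -ts le_vr_ell.
Qed.

Lemma coef_is_linear k a (x y : vr_chain F k) s :
  coef (a *: x + y) s = a * coef x s + coef y s.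
Proof.
by rewrite /coef; case: insubP => [t _ _|_]; rewrite ?ffunE ?mulr0 ?addr0.
Qed.

(** The simplices with [t] as a facet are the sets [v |: t] with [v] outside [t]. *)
Lemma vr_bd_coef k (c : vr_chain F k.+1) (t : simplex k) :
  vr_bd F k c t = \sum_(v | v \notin val t)
    (-1) ^+ vertex_pos (v |: val t) v * coef c (v |: val t).
Proof.
rewrite vr_bdE; under eq_bigr do rewrite /vr_inc mulr_sumr.
rewrite (exchange_big_dep predT)//= [RHS]big_mkcond/=.
apply: eq_bigr => v _; case: ifPn => [vt|].
  have ck : #|v |: val t| == k.+2 by rewrite cardsU1 vt (eqP (valP t)).
  pose s : simplex k.+1 := exist (fun r : {set T} => #|r| == k.+2) _ ck.
  rewrite (bigD1 s) ?setU11//= big1 ?addr0 => [|r /andP[vr rs]].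
    by rewrite setU1K// eqxx mulr1 mulrC -[coef c _]/(coef c (val s)) coef_val.
  case: eqP => [tE|_]; last by rewrite !mulr0.
  by case/eqP: rs; apply/val_inj; rewrite /= tE finset.setD1K.
rewrite negbK => vt; rewrite big1// => s vs; case: eqP => [tE|]; last by rewrite !mulr0.
by move: vt; rewrite tE !inE eqxx.
Qed.

Lemma vertex_pos_prod (s : {set T}) v : (-1) ^+ vertex_pos s v =
  \prod_(u in s) (if (enum_rank u < enum_rank v)%N then -1 else 1) :> F.
Proof.
by rewrite -big_mkcondr/= prodr_const; congr (_ ^+ _).
Qed.

Lemma vertex_posU1 (s : {set T}) v : vertex_pos (v |: s) v = vertex_pos s v.
Proof.
by apply: eq_card => u; rewrite !inE; case: eqVneq => // ->; rewrite ltnn !andbF.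
Qed.

End VRComplex.

(** * The chain map induced by an injection of vertices *)

Section VertexInjection.
Context (F : fieldType) {T T' : finType} (f : T' -> T) (f_inj : injective f).
Implicit Types (s : {set T'}) (t : {set T}).

Definition inversion_sign u v : F :=
  if (enum_rank u < enum_rank v)%N && ~~ (enum_rank (f u) < enum_rank (f v))%N
  then -1 else 1.

(* The sign of the permutation that sorts the [f]-image of an increasing
   enumeration of [s]. *)
Definition reorder_sign s : F :=
  \prod_(u in s) \prod_(v in s) inversion_sign u v.

Lemma reorder_sign_neq0 s : reorder_sign s != 0.
Proof.
apply/prodf_neq0 => u _; apply/prodf_neq0 => v _; rewrite /inversion_sign.
by case: ifP; rewrite ?oppr_eq0 oner_eq0.
Qed.

Lemma reorder_sign_sqr s : reorder_sign s * reorder_sign s = 1.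
Proof.
rewrite /reorder_sign -big_split big1//= => u _; rewrite -big_split big1//= => v _.
by rewrite /inversion_sign; case: ifP; rewrite ?mulrNN mulr1.
Qed.

Lemma reorder_signU1 s v : v \notin s -> reorder_sign (v |: s) =
  reorder_sign s * \prod_(u in s) (inversion_sign u v * inversion_sign v u).
Proof.
move=> vs; rewrite /reorder_sign big_setU1//= big_setU1//=.
under [X in _ * X]eq_bigr do rewrite big_setU1//.
rewrite !big_split/= {1}/inversion_sign ltnn mul1r mulrA mulrC.
by congr (_ * _); exact: mulrC.
Qed.

(** Compared factor by factor over [u] in [s]: [inversion_sign u v * inversion_sign v u] is -1
    exactly when [f] reverses the order of [u] and [v], that is, when [u] counts towards only one of
    the two vertex positions. *)
Lemma reorder_sign_vertex_pos s v : v \notin s ->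
  (-1) ^+ vertex_pos (f @: (v |: s)) (f v) * reorder_sign (v |: s) =
  reorder_sign s * (-1) ^+ vertex_pos (v |: s) v.
Proof.
move=> vs; rewrite imsetU1 !vertex_posU1 reorder_signU1// mulrCA; congr (_ * _).
rewrite !vertex_pos_prod big_imset/=; last by move=> ? ? _ _; exact: f_inj.
rewrite -big_split/=; apply: eq_bigr => u us.
have uv : u != v by apply: contraNneq vs => <-.
have rank_neq (A : finType) (x y : A) : x != y ->
    enum_rank x != enum_rank y :> nat.
  by rewrite (inj_eq val_inj) (inj_eq enum_rank_inj).
have fuv : f u != f v by rewrite (inj_eq f_inj).
move: (rank_neq _ _ _ fuv) (rank_neq _ _ _ uv); rewrite /inversion_sign.
by case: ltngtP => // _ _; case: ltngtP => //= _ _; rewrite ?(mulr1, mul1r, mulrNN).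
Qed.

Lemma preimset_inj s : f @^-1: (f @: s) = s.
Proof. by apply/setP => u; rewrite inE mem_imset. Qed.

Lemma card_preimset_le t : (#|f @^-1: t| <= #|t|)%N.
Proof.
rewrite -(card_imset _ f_inj); apply: subset_leq_card.
by apply/fintype.subsetP => _ /imsetP[u ut ->]; move: ut; rewrite inE.
Qed.

Lemma imset_preim t : #|f @^-1: t| = #|t| -> f @: (f @^-1: t) = t.
Proof.
move=> e; apply/eqP; rewrite eqEcard card_imset// e leqnn andbT.
by apply/fintype.subsetP => _ /imsetP[u ut ->]; move: ut; rewrite inE.
Qed.

(** The sign compares the two vertex orders. If [t] is not the image of a simplex, injectivity makes
    its preimage too small and [coef] returns 0. *)
Definition vr_push k (c : vr_chain F k) : vr_chain F k :=
  [ffun t : @simplex T k => reorder_sign (f @^-1: val t) *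
    coef (c : @vr_chain F T' k) (f @^-1: val t)].

Fact vr_push_linear k : linear (@vr_push k).
Proof.
move=> a x y; apply/ffunP => t; rewrite !ffunE coef_is_linear mulrDr.
by rewrite mulrCA.
Qed.

HB.instance Definition _ k := GRing.isLinear.Build F (@vr_chain F T' k)
  (@vr_chain F T k) _ (@vr_push k) (@vr_push_linear k).

Lemma linfun_vr_push k c : linfun (@vr_push k) c = vr_push c.
Proof. exact: lfunE. Qed.

Lemma coef_push k (c : vr_chain F k) t : coef (vr_push c) t =
  reorder_sign (f @^-1: t) * coef (c : @vr_chain F T' k) (f @^-1: t) *
    (#|t| == k.+1)%:R.
Proof.
rewrite (coef_ffun _ (fun t => reorder_sign (f @^-1: t) * coef c (f @^-1: t))).
by case: ifP; rewrite ?mulr1 ?mulr0.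
Qed.

Lemma vr_push_bd k (c : vr_chain F k.+1) :
  vr_bd F k (vr_push c) = vr_push (vr_bd F k (c : @vr_chain F T' k.+1)).
Proof.
apply/ffunP => t; rewrite vr_bd_coef ffunE; set s := f @^-1: val t.
have tk := eqP (valP t).
have tvk v : v \notin val t -> (#|v |: val t| == k.+2).
  by move=> vt; rewrite cardsU1 vt tk.
under eq_bigr => v vt do rewrite coef_push (tvk _ vt) mulr1.
(* If the preimage of [t] has at most [k] points, that of [v |: t] has fewer than [k.+2], and both
   sides vanish. *)
have [sk|sk] := eqVneq #|s| k.+1; last first.
  rewrite coef_out// mulr0 big1// => v vt; rewrite coef_out ?mulr0//.
  have sk' : (#|s| <= k)%N.
    by rewrite -ltnS ltn_neqAle sk -tk card_preimset_le.
  apply: contra_neqN sk => /eqP e.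
  have : (#|f @^-1: (v |: val t)| <= #|s|.+1)%N.
    rewrite [f @^-1: _](_ : _ = f @^-1: [set v]%SET :|: s); last first.
      by apply/setP => u; rewrite !inE.
    apply: leq_trans (leq_card_setU _ _) _.
    by rewrite addnC -addn1 leq_add2l (leq_trans (card_preimset_le _))// cards1.
  by rewrite e ltnS ltnNge sk'.
have ts : f @: s = val t by rewrite imset_preim// tk.
have cs : #|s| == k.+1 by rewrite sk.
rewrite -[s]/(val (exist (fun r : {set T'} => #|r| == k.+1) s cs : simplex k)).
rewrite coef_val vr_bd_coef /= mulr_sumr.
(* A vertex outside the image of [f] does not enlarge the preimage, so its term vanishes. *)
rewrite (bigID (fun v => v \in codom f))/= [X in _ + X]big1 ?addr0; last first.
  move=> v /andP[vt vf]; rewrite (_ : f @^-1: _ = s).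
    by rewrite coef_out ?mulr0// sk neq_ltn ltnSn.
  apply/setP => u; rewrite !inE; case: eqVneq => // fuv.
  by case/negP: vf; rewrite -fuv codom_f.
rewrite (eq_bigl [in f @: ~: s]) => [|v]; last first.
  apply/andP/imsetP => [[vt /codomP[u vE]]|[u us ->]].
    by exists u => //; rewrite !inE -vE.
  by move: us; rewrite !inE codom_f.
rewrite big_imset/=; last by move=> ? ? _ _; exact: f_inj.
apply: eq_big => u; rewrite !inE// => us.
have -> : f @^-1: (f u |: val t) = u |: s.
  by apply/setP => w; rewrite !inE (inj_eq f_inj).
by rewrite -ts -imsetU1 !mulrA reorder_sign_vertex_pos// inE.
Qed.

End VertexInjection.

Section PushFiltration.
Context {R : realType} (F : fieldType) {T T' : finType} (f : T' -> T).
Context (f_inj : injective f) (d : pseudometric R T) (d' : pseudometric R T').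
Hypothesis f_dist : forall u v, d (f u) (f v) = d' u v.

Lemma imset_simplex k (s : @simplex T' k) : #|f @: val s| == k.+1.
Proof. by rewrite card_imset// (valP s). Qed.

Lemma coef_push_neq0 k (c : @vr_chain F T' k) (t : @simplex T k) :
  vr_push f c t != 0 -> f @: (f @^-1: val t) = val t.
Proof.
rewrite ffunE mulf_eq0 negb_or => /andP[_ /(coef_neq0 d')[/eqP tk _]].
by apply: (imset_preim f_inj); rewrite tk (eqP (valP t)).
Qed.

Lemma vr_push_ell k (c : @vr_chain F T' k) : vr_ell d (vr_push f c) = vr_ell d' c.
Proof.
apply/le_anti/andP; split; apply/vr_ell_leP => s cs.
  rewrite -(coef_push_neq0 cs) (diam_imset _ f_dist).
  by move: cs; rewrite ffunE mulf_eq0 negb_or => /andP[_ /(coef_neq0 d')[]].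
rewrite -(diam_imset _ f_dist).
pose t : simplex k := exist (fun r : {set T} => #|r| == k.+1) _ (imset_simplex s).
rewrite -[f @: _]/(val t); apply: le_vr_ell.
by rewrite ffunE/= preimset_inj// coef_val mulf_neq0// reorder_sign_neq0.
Qed.

(** The sign is its own inverse, so reading coefficients along images with the same sign inverts the
    push. *)
Lemma vr_push_onto k (c : @vr_chain F T k) :
  (forall t, c t != 0 -> {subset val t <= codom f}) ->
  exists c', c = vr_push f c'.
Proof.
move=> cf; exists [ffun s : @simplex T' k =>
  reorder_sign F f (val s) * coef c (f @: val s)].
apply/ffunP => t; rewrite ffunE.
rewrite (coef_ffun _ (fun s => reorder_sign F f s * coef c (f @: s))).
have [c0|/cf tf] := eqVneq (c t) 0.
  case: ifP => [/eqP tk|]; last by rewrite mulr0 c0.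
  by rewrite (imset_preim f_inj) ?tk ?(eqP (valP t))// coef_val c0 !mulr0.
have ft : f @: (f @^-1: val t) = val t.
  apply/setP => v; apply/imsetP/idP => [[u ut ->]|vt]; first by rewrite inE in ut.
  by have /codomP[u vE] := tf v vt; exists u => //; rewrite inE -vE.
rewrite -(card_imset _ f_inj) ft (valP t) coef_val mulrA.
by rewrite reorder_sign_sqr mul1r.
Qed.

End PushFiltration.

(** [sign_vertex_pos], which orders the two vertices, made symmetric in them by multiplying with
    signs of square 1. *)
Lemma vertex_pos_swap (F : fieldType) (T : finType) (s : {set T}) v w :
  v != w -> v \in s -> w \in s ->
  (-1) ^+ vertex_pos s v * (-1) ^+ vertex_pos s w =
  - ((-1) ^+ vertex_pos (s :\ v) w * (-1) ^+ vertex_pos (s :\ w) v) :> F.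
Proof.
move=> vw vs ws.
have sgn n : (-1) ^+ n * (-1) ^+ n = 1 :> F by rewrite -expr2 sqrr_sign.
suff : (-1) ^+ vertex_pos s v * (-1) ^+ vertex_pos (s :\ v) w =
    - ((-1) ^+ vertex_pos s w * (-1) ^+ vertex_pos (s :\ w) v) :> F.
  move: (sgn (vertex_pos (s :\ v) w)) (sgn (vertex_pos s w)).
  move: (_ ^+ _) (_ ^+ _) (_ ^+ _) (_ ^+ _) => a b c e aa bb ca.
  by rewrite -[LHS]mulr1 -aa mulrACA ca mulNr mulrACA bb mul1r [e * a]mulrC.
move: vw; rewrite -(inj_eq enum_rank_inj) -(inj_eq val_inj)/=.
case: ltngtP => // vw _; first exact: sign_vertex_pos.
by rewrite (sign_vertex_pos F vw ws) opprK.
Qed.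

(* The prism operator of the vertex map sending [z'] to [z]. *)
Section Collapse.
Context {R : realType} (F : fieldType) {T : finType} (d : pseudometric R T).
Context (z z' : T) (zz' : z != z') (d_zz' : d z z' = 0).

(** Simplices containing [z'] but not [z] are coned off from [z]; the sign stands for [z] being put
    in front. *)
Definition vr_cone k (c : vr_chain F k) : vr_chain F k.+1 :=
  [ffun t : @simplex T k.+1 => if (z \in val t) && (z' \in val t) then
     (-1) ^+ vertex_pos (val t) z * coef (c : @vr_chain F T k) (val t :\ z) else 0].

Fact vr_cone_linear k : linear (@vr_cone k).
Proof.
move=> a x y; apply/ffunP => t; rewrite !ffunE; case: ifP => _.
  by rewrite coef_is_linear mulrDr mulrCA.
by rewrite scaler0 addr0.
Qed.

HB.instance Definition _ k := GRing.isLinear.Build F (@vr_chain F T k)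
  (@vr_chain F T k.+1) _ (@vr_cone k) (@vr_cone_linear k).

Lemma linfun_vr_cone k c : linfun (@vr_cone k) c = vr_cone c.
Proof. exact: lfunE. Qed.

(** Defined through its homotopy to the identity, which makes the chain map property formal; that it
    projects onto the chains avoiding [z'] is [vr_collapse_out] and [vr_collapse_id]. *)
Definition vr_collapse k : 'Hom(@vr_chain F T k, @vr_chain F T k) :=
  \1%VF - (vr_bd F k \o linfun (@vr_cone k))%VF -
  match k return 'Hom(@vr_chain F T k, @vr_chain F T k) with
  | 0%N => 0
  | k'.+1 => (linfun (@vr_cone k') \o vr_bd F k')%VF
  end.

Lemma vr_collapse0 (c : @vr_chain F T 0) :
  vr_collapse 0 c = c - vr_bd F 0 (vr_cone c).
Proof.
rewrite /vr_collapse subr0 add_lfunE opp_lfunE id_lfunE comp_lfunE.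
by rewrite linfun_vr_cone.
Qed.

Lemma vr_collapseS k (c : @vr_chain F T k.+1) :
  vr_collapse k.+1 c = c - vr_bd F k.+1 (vr_cone c) - vr_cone (vr_bd F k c).
Proof.
rewrite /vr_collapse !(add_lfunE, opp_lfunE, id_lfunE, comp_lfunE).
by rewrite !linfun_vr_cone.
Qed.

Lemma coef_cone k (c : vr_chain F k) (s : {set T}) :
  coef (vr_cone c) s = if [&& #|s| == k.+2, z \in s & z' \in s] then
     (-1) ^+ vertex_pos s z * coef (c : @vr_chain F T k) (s :\ z) else 0.
Proof.
rewrite (coef_ffun _ (fun s => if (z \in s) && (z' \in s) then
     (-1) ^+ vertex_pos s z * coef c (s :\ z) else 0)).
by case: ifP.
Qed.

(** Coned simplices already contain [z'], at distance 0 from [z], so adding [z] does not increase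
    the diameter. *)
Lemma vr_cone_ell k (c : vr_chain F k) :
  (vr_ell d (vr_cone c) <= vr_ell d (c : @vr_chain F T k))%E.
Proof.
apply/vr_ell_leP => t; rewrite ffunE; case: ifP => [/andP[zt z't]|]; last by rewrite eqxx.
rewrite mulf_eq0 negb_or => /andP[_ /(coef_neq0 d)[_]]; apply: le_trans.
have z't' : z' \in val t :\ z by rewrite !inE eq_sym zz'.
have dz v : d z v <= d z' v by have := pdist_triangle d z z' v; rewrite d_zz' add0r.
rewrite lee_fin; apply/diam_leP; split=> [|u v ut vt]; first exact: diam_ge0.
have [->|uz] := eqVneq u z; have [->|vz] := eqVneq v z.
- by rewrite pdistxx diam_ge0.
- by apply: le_trans (dz v) _; rewrite le_diam// !inE vz.
- by rewrite pdist_sym; apply: le_trans (dz u) _; rewrite le_diam// !inE uz.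
- by rewrite le_diam// !inE ?uz ?vz.
Qed.

Lemma vr_bd_cone k (c : vr_chain F k) (t : @simplex T k) :
  vr_bd F k (vr_cone c) t = \sum_(v | v \notin val t)
    (if (z \in v |: val t) && (z' \in v |: val t) then
      (-1) ^+ vertex_pos (v |: val t) v * (-1) ^+ vertex_pos (v |: val t) z *
        coef (c : @vr_chain F T k) ((v |: val t) :\ z) else 0).
Proof.
rewrite vr_bd_coef; apply: eq_bigr => v vt; rewrite coef_cone.
rewrite cardsU1 vt (eqP (valP t)) eqxx/=.
by case: ifP => _; rewrite ?mulr0// mulrA.
Qed.

Lemma vr_bd_cone_notin k (c : vr_chain F k) (t : @simplex T k) :
  z' \in val t -> z \notin val t -> vr_bd F k (vr_cone c) t = c t.
Proof.
move=> z't zt; rewrite vr_bd_cone (bigD1 z)//= big1 ?addr0 => [|v /andP[vt vz]].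
  rewrite !inE eqxx z't orbT/= -expr2 sqrr_sign mul1r finset.setU1K//.
  exact: coef_val.
by rewrite !inE (negPf zt) eq_sym (negPf vz).
Qed.

(** If [z] is not in [t], the boundary of the cone contributes [c t] and the cone of the boundary
    nothing. If it is, the cone of the boundary contributes [c t] through the vertex [z], and its
    other terms cancel against the boundary of the cone by [vertex_pos_swap]. *)
Lemma vr_collapse_out k (c : vr_chain F k) (t : @simplex T k) :
  z' \in val t -> vr_collapse k c t = 0.
Proof.
move=> z't; have [zt|zt] := boolP (z \in val t); last first.
  case: k c t z't zt => [|k] c t z't zt.
    by rewrite vr_collapse0 !ffunE vr_bd_cone_notin// subrr.
  rewrite vr_collapseS !ffunE vr_bd_cone_notin// subrr (negPf zt)/=.
  by rewrite subr0.
case: k c t z't zt => [|k] c t z't zt.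
  have /cards1P[x tE] := valP t; move: zz' zt z't.
  by rewrite tE !inE => + /eqP zx /eqP z'x; rewrite zx z'x eqxx.
rewrite vr_collapseS !ffunE zt z't/= vr_bd_cone.
have tzk : #|val t :\ z| == k.+1.
  by have := valP t; rewrite (cardsD1 z) zt.
rewrite -[val t :\ z]/(val (exist (fun r : {set T} => #|r| == k.+1) _ tzk : simplex k)).
rewrite coef_val vr_bd_coef/= mulr_sumr [X in _ - _ - X](bigD1 z)/=; last first.
  by rewrite !inE eqxx.
rewrite finset.setD1K// coef_val mulrA -expr2 sqrr_sign mul1r.
rewrite opprD addrACA subrr add0r -opprD; apply/eqP.
rewrite oppr_eq0 [X in _ + X](eq_bigl (fun v => v \notin val t)); last first.
  move=> v; rewrite !inE; case: eqVneq => [->|]//=; first by rewrite zt.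
  by rewrite andbT.
rewrite -big_split/= big1// => v vt.
have zv : z != v by apply: contraNneq vt => <-.
rewrite !inE zt z't !orbT/=.
have -> : (v |: val t) :\ z = v |: (val t :\ z).
  by apply/setP => w; rewrite !inE; case: (eqVneq w v) => [->|]//=; rewrite eq_sym zv.
have := @vertex_pos_swap F T (v |: val t) v z.
rewrite eq_sym zv !inE eqxx zt orbT finset.setU1K// => /(_ isT isT isT) ->.
have -> : (v |: val t) :\ z = v |: (val t :\ z).
  by apply/setP => w; rewrite !inE; case: (eqVneq w v) => [->|]//=; rewrite eq_sym zv.
by rewrite mulNr mulrA addNr.
Qed.

(** The terms of the cone of [c] read [c] at simplices containing [z'], and any cone vanishes at
    simplices without [z']. *)
Lemma vr_collapse_id k (c : vr_chain F k) :
  (forall t : @simplex T k, z' \in val t -> c t = 0) -> vr_collapse k c = c.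
Proof.
move=> c0; apply/ffunP => t.
have [z't|z't] := boolP (z' \in val t); first by rewrite vr_collapse_out// c0.
have bd0 : vr_bd F k (vr_cone c) t = 0.
  rewrite vr_bd_cone big1// => v vt; case: ifP => // /andP[_].
  rewrite !inE (negPf z't) orbF => /eqP <-.
  rewrite /coef; case: insubP => [s _ sE|]; last by rewrite mulr0.
  by rewrite c0 ?mulr0// sE !inE eqxx eq_sym zz'.
case: k c c0 t z't bd0 => [|k] c c0 t z't bd0.
  by rewrite vr_collapse0 !ffunE bd0 subr0.
by rewrite vr_collapseS !ffunE bd0 (negPf z't) andbF !subr0.
Qed.

Lemma vr_collapse_bd k (c : vr_chain F k.+1) :
  vr_bd F k (vr_collapse k.+1 c) = vr_collapse k (vr_bd F k c).
Proof.
rewrite vr_collapseS !linearB/= vr_bd_bd subr0.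
case: k c => [|k] c; first by rewrite vr_collapse0.
by rewrite vr_collapseS vr_bd_bd linear0 subr0.
Qed.

Lemma vr_collapse_ell k (c : vr_chain F k) :
  (vr_ell d (vr_collapse k c) <= vr_ell d c)%E.
Proof.
have hv j := ell_valuation (VR_finite_range F d) j.
have cone_bd j (x : @vr_chain F T j) :
    (vr_ell d (vr_bd F j (vr_cone x)) <= vr_ell d x)%E.
  exact: le_trans (vr_ell_bd _ _) (vr_cone_ell _).
case: k c => [|k] c.
  by rewrite vr_collapse0; apply: (valuB_le (hv _)); [exact: lexx|exact: cone_bd].
rewrite vr_collapseS; apply: (valuB_le (hv _)).
  by apply: (valuB_le (hv _)); [exact: lexx|exact: cone_bd].
exact: le_trans (vr_cone_ell _) (vr_ell_bd _ _).
Qed.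

Lemma vr_collapse_cycle k (c : vr_chain F k) : c \in cycles (VR F d) k ->
  vr_bd F k (vr_cone c) = c - vr_collapse k c.
Proof.
case: k c => [|k] c; first by rewrite vr_collapse0 opprB addrC subrK.
rewrite memv_ker => /eqP c0; rewrite vr_collapseS [vr_bd F k c]c0 linear0 subr0.
by rewrite opprB addrC subrK.
Qed.

End Collapse.

(** * Barcodes of pullbacks along surjections *)

Section PullbackBarcode.
Context {R : realType} (F : fieldType).

Definition diagonal_seq (es : seq (\bar R)) : seq (\bar R * \bar R) :=
  [seq (e, e) | e <- es].

Lemma VR_ell_ge0 (T : finType) (d : pseudometric R T) k
    (ws : seq (chain (VR F d) k)) : {in ws, forall w, w != 0} ->
  {in [seq ell (VR F d) w | w <- ws], forall e, (0 <= e)%E}.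
Proof. by move=> ws0 _ /mapP[w /ws0/VR_ell_fin[r r0 ->] ->]; rewrite lee_fin. Qed.

(** The retraction is the identity with zero homotopy; this is the base case of
    [pullback_barcode]. *)
Lemma bijective_barcode (T T' : finType) (f : T' -> T) (d : pseudometric R T)
    (d' : pseudometric R T') k : bijective f ->
  (forall u v, d (f u) (f v) = d' u v) ->
  exists2 es : seq (\bar R), {in es, forall e, (0 <= e)%E} &
    ms_matched eq (multiset_of_seq (verbose_barcode (VR F d) k))
      (multiset_of_seq (verbose_barcode (VR F d') k ++ diagonal_seq es)).
Proof.
move=> f_bij fd; have f_inj := bij_inj f_bij; have [g gf fg] := f_bij.
have [||||||x xZ|ws ws0 m] := @retract_barcode R F (VR F d) (VR F d')
  (VR_finite_range F d) (VR_finite_range F d')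
  (fun k => linfun (@vr_push F T T' f k)) (fun k => \1%VF) k.
- by move=> j x; rewrite !linfun_vr_push; exact: vr_push_bd.
- by move=> j x; rewrite linfun_vr_push; exact: vr_push_ell.
- by move=> j x; rewrite !id_lfunE.
- by move=> j x; rewrite id_lfunE.
- move=> j x; rewrite id_lfunE.
  have [|y ->] := @vr_push_onto F T T' f f_inj j x.
    by move=> t _ v _; rewrite -[v]fg codom_f.
  by exists y; rewrite linfun_vr_push.
- by move=> j y; rewrite id_lfunE.
- exists 0; first by rewrite linear0 id_lfunE subrr.
  by rewrite (valu0 (ell_valuation (VR_finite_range F d) _)) leNye.
exists [seq ell (VR F d) w | w <- ws]; first exact: VR_ell_ge0.
by rewrite /diagonal_seq -map_comp.
Qed.

(** The retraction is the collapse of [z'] onto [z], whose image consists of pushed chains, and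
    [vr_cone] is the homotopy. *)
Lemma duplicate_barcode (T T' : finType) (f : T' -> T) (d : pseudometric R T)
    (d' : pseudometric R T') (z z' : T) k : injective f ->
  (forall u v, d (f u) (f v) = d' u v) ->
  z != z' -> d z z' = 0 -> (forall v, (v \in codom f) = (v != z')) ->
  exists2 es : seq (\bar R), {in es, forall e, (0 <= e)%E} &
    ms_matched eq (multiset_of_seq (verbose_barcode (VR F d) k))
      (multiset_of_seq (verbose_barcode (VR F d') k ++ diagonal_seq es)).
Proof.
move=> f_inj fd zz' dzz' cf.
have [||||||x xZ|ws ws0 m] := @retract_barcode R F (VR F d) (VR F d')
  (VR_finite_range F d) (VR_finite_range F d')
  (fun k => linfun (@vr_push F T T' f k)) (vr_collapse F z z') k.
- by move=> j x; rewrite !linfun_vr_push; exact: vr_push_bd.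
- by move=> j x; rewrite linfun_vr_push; exact: vr_push_ell.
- by move=> j x; exact: vr_collapse_bd.
- by move=> j x; exact: vr_collapse_ell.
- move=> j x; have [|y ->] := @vr_push_onto F T T' f f_inj j (vr_collapse F z z' j x).
    move=> t xt v vt; rewrite cf; apply: contraNneq xt => vz'.
    by rewrite vr_collapse_out// -vz'.
  by exists y; rewrite linfun_vr_push.
- move=> j y; rewrite linfun_vr_push; apply: vr_collapse_id => // t z't.
  apply/eqP; apply: contraTT z't => yt; rewrite -(coef_push_neq0 f_inj d' yt).
  apply/imsetP => -[u _ z'E].
  by have := cf z'; rewrite eqxx z'E codom_f.
- by exists (vr_cone z z' x); [exact: vr_collapse_cycle xZ|exact: vr_cone_ell].
exists [seq ell (VR F d) w | w <- ws]; first exact: VR_ell_ge0.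
by rewrite /diagonal_seq -map_comp.
Qed.

Lemma ms_cat_congr (S : Type) (s s' t : seq S) :
  ms_matched eq (multiset_of_seq s) (multiset_of_seq s') ->
  ms_matched eq (multiset_of_seq (s ++ t)) (multiset_of_seq (s' ++ t)).
Proof.
move=> ss'; apply: ms_matched_eql (ms_cat s t) _.
apply: ms_matched_eqr (ms_cat s' t); apply: ms_matched_sum => //.
exact: ms_matched_refl.
Qed.

(** Induction on the number of vertices: two vertices with the same image are at distance 0, and one
    of them is removed. *)
Lemma pullback_barcode (X : finType) (d : pseudometric R X) (T : finType)
    (phi : T -> X) k : set_surj setT setT phi ->
  exists2 es : seq (\bar R), {in es, forall e, (0 <= e)%E} &
    ms_matched eq (multiset_of_seq (verbose_barcode (VR F (pullback d phi)) k))
      (multiset_of_seq (verbose_barcode (VR F d) k ++ diagonal_seq es)).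
Proof.
have [n] := ubnP #|T|; elim: n => // n IHn in T phi *; rewrite ltnS => Tn phis.
have [/injectiveP phi_inj|] := boolP (injectiveb phi).
  have [g gphi] : exists g, cancel g phi.
    have ex x : exists t, phi t = x by have [t _ <-] := phis x I; exists t.
    by exists (fun x => sval (cid (ex x))) => x; case: cid.
  apply: (bijective_barcode (f := g)); last first.
    by move=> u v /=; rewrite !gphi.
  by exists phi => //; move=> t; apply: phi_inj; rewrite gphi.
move=> /injectivePn[z [z' zz' phizz']].
pose T' : finType := {x | x != z'}; pose f : T' -> T := val.
have [|||||es es0 m] := @duplicate_barcode T T' f (pullback d phi)
  (pullback d (phi \o f)) z z' k.
- exact: val_inj.
- by [].
- by [].
- by rewrite /= phizz' pdistxx.
- move=> v; apply/codomP/idP => [[u ->]|vz']; first by case: u.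
  by exists (exist _ v vz').
have [||es' es'0 m'] := IHn T' (phi \o f).
- apply: leq_trans Tn; rewrite card_sig (_ : #|_| = #|predC1 z'|); last exact: eq_card.
  by rewrite cardC1 prednK//; apply/card_gt0P; exists z.
- move=> x _; have [t _ tx] := phis x I.
  (* A point reached from the removed vertex [z'] is still reached from [z]. *)
  have [tz'|tz'] := eqVneq t z'; last by exists (exist _ t tz').
  by exists (exist _ z zz') => //=; rewrite phizz' -tz'.
exists (es' ++ es).
  by move=> e; rewrite mem_cat => /orP[/es'0|/es0].
apply: (ms_matched_eql m); rewrite /diagonal_seq map_cat catA.
exact: ms_cat_congr.
Qed.

End PullbackBarcode.

(** * Distances *)

Section Distances.
Context {R : realType}.
Implicit Types A B : multiset (\bar R * \bar R).

Lemma matching_dist_le A B (c : \bar R) : (0 <= c)%E ->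
  ms_matched (fun x y => (point_dist x y <= c)%E) A B ->
  (matching_dist A B <= c)%E.
Proof.
move=> c0 [phi phib phic].
apply: (@le_trans _ _ (maxe 0%E (ereal_sup (range (fun i : ms_index A =>
    point_dist (ms_elem i) (ms_elem (phi i))))))).
  by apply: ereal_inf_lbound; exists phi.
by rewrite ge_max c0/=; apply: ge_ereal_sup => _ [i _ <-].
Qed.

Lemma coord_dist_le (p q : \bar R) (delta : R) : 0 <= delta ->
  (p <= q + delta%:E)%E -> (q <= p + delta%:E)%E ->
  (coord_dist p q <= delta%:E)%E.
Proof.
move=> d0; rewrite /coord_dist; case: eqVneq => [_ _ _|]; first by rewrite lee_fin.
case: p q => [p| |] [q| |]//= _; rewrite ?lee_fin => pq qp //.
by rewrite ler_distl; apply/andP; split; rewrite ?lerBlDr.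
Qed.

(** As [delta] is finite, the bounds exclude that exactly one of the second coordinates is [+oo]. *)
Lemma point_dist_le (x y : \bar R * \bar R) (delta : R) : 0 <= delta ->
  (x.1 <= y.1 + delta%:E)%E -> (y.1 <= x.1 + delta%:E)%E ->
  (x.2 <= y.2 + delta%:E)%E -> (y.2 <= x.2 + delta%:E)%E ->
  (point_dist x y <= delta%:E)%E.
Proof.
move=> d0 xy1 yx1 xy2 yx2; have h1 := coord_dist_le d0 xy1 yx1.
have h2 := coord_dist_le d0 xy2 yx2; rewrite /point_dist.
case: ifPn => [_|]; first by rewrite ge_max h1 h2.
rewrite !ltey negb_and !negbK => xy; case: ifPn => [//|/negP[]].
case/orP: xy => /eqP e; rewrite e eqxx ?andbT/= -leye_eq.
  by move: xy2; rewrite e; case: (y.2).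
by move: yx2; rewrite e; case: (x.2).
Qed.

Lemma point_dist_diag (r : \bar R) : point_dist (r, r) (r, r) = 0%E.
Proof.
rewrite /point_dist /coord_dist/= eqxx maxxx andbb ltey andbb.
by case: eqP.
Qed.

Let Delta : multiset (\bar R * \bar R) := diagonal_multiset.

(** Hilbert's hotel: the new bar takes index 0 and the other copies of [(e, e)] move up by one. *)
Lemma diagonal_absorb1 (e : \bar R) : (0 <= e)%E ->
  ms_matched eq (msum (multiset_of_seq [:: (e, e)]) Delta) Delta.
Proof.
move=> e0; pose p0 : {r : \bar R | (0 <= r)%E} := exist _ e e0.
exists (fun i : 'I_1 + {r : \bar R | (0 <= r)%E} * nat => match i with
  | inl _ => (p0, 0%N)
  | inr (r, n) => if sval r == e then (r, n.+1) else (r, n) end).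
  exists (fun i : {r : \bar R | (0 <= r)%E} * nat =>
    let: (r, n) := i in if sval r == e then
      if n is n'.+1 then inr (r, n') else inl ord0 else inr (r, n)).
    move=> [i|[r n]]; first by rewrite /= eqxx [i]ord1.
    by case: ifPn => [re|/negPf re]; rewrite re.
  move=> [r n]; case: ifPn => [/eqP re|/negPf ->//].
  case: n => [|n]; last by rewrite re eqxx.
  by congr (_, _); apply: val_inj.
by move=> [i|[r n]] /=; [rewrite [i]ord1|case: ifP].
Qed.

Lemma diagonal_absorb (es : seq (\bar R)) : {in es, forall e, (0 <= e)%E} ->
  ms_matched eq (msum (multiset_of_seq (diagonal_seq es)) Delta) Delta.
Proof.
elim: es => [|e es IHes] es0.
  exists (fun i : 'I_0 + ms_index Delta =>
    if i is inr x then x else (exist _ 0%E (lexx _), 0%N)).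
    by exists inr => // -[i|i]//; have := ltn_ord i.
  by move=> [i|i]//; have := ltn_ord i.
have {}IHes := IHes (fun x xes => es0 x (mem_behead (s := e :: es) xes)).
apply: ms_matched_eql (ms_matched_sum (ms_cat [:: (e, e)] (diagonal_seq es))
  (ms_matched_refl _ _)) _ => //.
apply: ms_matched_eql (ms_matched_sym (r2 := eq) (fun _ _ => esym) (ms_sumA _ _ _)) _.
apply: ms_matched_eql (ms_matched_sum (ms_matched_refl _ _) IHes) _ => //.
by apply: diagonal_absorb1; rewrite es0// mem_head.
Qed.

Lemma matched_mod_diagonal (s t : seq (\bar R * \bar R)) (es : seq (\bar R)) :
  {in es, forall e, (0 <= e)%E} ->
  ms_matched eq (multiset_of_seq s) (multiset_of_seq (t ++ diagonal_seq es)) ->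
  ms_matched eq (msum (multiset_of_seq s) Delta) (msum (multiset_of_seq t) Delta).
Proof.
move=> es0 st; have r A : ms_matched eq A A by apply: ms_matched_refl.
apply: ms_matched_eql (ms_matched_sum st (r _)) _.
apply: ms_matched_eql (ms_matched_sum (ms_cat _ _) (r _)) _.
apply: ms_matched_eql (ms_matched_sym (r2 := eq) (fun _ _ => esym) (ms_sumA _ _ _)) _.
exact: ms_matched_sum (r _) (diagonal_absorb es0).
Qed.

End Distances.

(** * The three inequalities *)

Section Stability.
Context {R : realType} (F : fieldType).

(** Since [ell <= rho], a bar that is not concise has equal coordinates. *)
Lemma concise_mod_diagonal (T : finType) (d : pseudometric R T) k :
  exists2 es : seq (\bar R), {in es, forall e, (0 <= e)%E} &
  ms_matched eq (multiset_of_seq (verbose_barcode (VR F d) k))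
    (multiset_of_seq (concise_barcode (VR F d) k ++ diagonal_seq es)).
Proof.
have [xs [bx _ _ E]] := verbose_barcodeE (VR_finite_range F d) k.
rewrite /concise_barcode E; set p := fun pq : \bar R * \bar R => (pq.1 < pq.2)%E.
set s := [seq _ | x <- xs].
exists (map fst (seq.filter (predC p) s)).
  move=> _ /mapP[pq + ->]; rewrite mem_filter => /andP[_ /mapP[x xxs ->]] /=.
  have [r r0 xr] := VR_ell_fin (basis_not0 bx xxs).
  by rewrite -[X in (_ <= X)%E]/(ell (VR F d) x) xr lee_fin.
apply: ms_perm; rewrite perm_sym (_ : diagonal_seq _ = seq.filter (predC p) s).
  by rewrite (permEl (perm_filterC p s)).
rewrite /diagonal_seq -map_comp -[RHS]map_id; apply/eq_in_map => pq.
rewrite mem_filter => /andP[np /mapP[x _ pqE]]; move: np.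
rewrite pqE /p/= -leNgt => xr.
by congr (_, _); apply/le_anti/andP; split; [exact: ell_le_rho|exact: xr].
Qed.

(** Both are compared with the verbose barcode of [X], from which each differs by diagonal bars
    only. *)
Lemma pullback_mod_diagonal (X : finMetricType R) (Z : finType) (phi : Z -> X) k :
  set_surj setT setT phi ->
  ms_matched eq
    (msum (concise_bars F (metric_pseudometric X) k) diagonal_multiset)
    (msum (verbose_bars F (pullback (metric_pseudometric X) phi) k)
      diagonal_multiset).
Proof.
move=> phis; apply: (ms_matched_sym (r1 := eq)) => //.
have [es es0 m] := pullback_barcode F (metric_pseudometric X) k phis.
have [es' es'0 m'] := concise_mod_diagonal (metric_pseudometric X) k.
apply: ms_matched_eql (matched_mod_diagonal es0 m) _.
exact: matched_mod_diagonal es'0 m'.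
Qed.

Lemma bottleneck_le_pullback (X Y : finMetricType R) k :
  (bottleneck_dist (concise_bars F (metric_pseudometric X) k)
     (concise_bars F (metric_pseudometric Y) k) <= pullback_bottleneck F X Y k)%E.
Proof.
apply: le_ereal_inf_tmp => _ [Z [phiX [phiY [sX sY ->]]]].
apply: le_ereal_inf_tmp => _ [phi phib <-]; set c := maxe _ _.
have c0 : (0 <= c)%E by rewrite le_max lexx.
apply: matching_dist_le => //.
apply: ms_matched_eql (pullback_mod_diagonal k sX) _.
apply: ms_matched_eqr (pullback_mod_diagonal k sY).
(* The bijection of verbose bars is extended by the identity of the diagonal, at no cost. *)
apply: ms_matched_sum.
  exists phi => // i; rewrite le_max; apply/orP; right.
  by apply: ereal_sup_ubound; exists i.
by exists id => [|i]; [exists id|rewrite /= point_dist_diag].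
Qed.

Lemma matching_le_interleaving (T T' : finType) (d : pseudometric R T)
    (d' : pseudometric R T') k :
  (matching_dist (verbose_bars F d k) (verbose_bars F d' k) <=
   interleaving_dist (VR F d) (VR F d'))%E.
Proof.
apply: le_ereal_inf_tmp => _ [delta [delta0 inter] <-].
(* No chain of either complex has a filtration value above [M]. *)
pose M := Num.max (diam d (finset.setTfor T)) (diam d' (finset.setTfor T')).
have [||f [g [[fbd gbd] fg gf fell gell]]] := interleaved_iso (M := M) _ _ delta0 inter.
- by move=> j x; apply: le_trans (VR_ell_le x) _; rewrite lee_fin le_max lexx.
- by move=> j x; apply: le_trans (VR_ell_le x) _; rewrite lee_fin le_max lexx orbT.
apply: matching_dist_le; first by rewrite lee_fin.
have := iso_barcode_matching (VR_finite_range F d) (VR_finite_range F d')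
  (h := fun e => (e + delta%:E)%E) k _ _ fbd gbd fg gf fell gell.
move=> /(_ (fun x y xy => leeD xy (lexx _)) erefl).
by apply: ms_matched_impl => x y [[? ?] [? ?]]; exact: point_dist_le.
Qed.

Lemma pullback_le_interleaving (X Y : finMetricType R) k :
  (pullback_bottleneck F X Y k <= pullback_interleaving F X Y)%E.
Proof.
apply: le_ereal_inf_tmp => _ [Z [phiX [phiY [sX sY ->]]]].
apply: le_trans (matching_le_interleaving _ _ k).
by apply: ereal_inf_lbound; exists Z, phiX, phiY.
Qed.

(** The two complexes differ only in their filtrations, so only diameters are compared. *)
Lemma identity_interleaved (T : finType) (d d' : pseudometric R T) (delta : R) :
  0 <= delta -> (forall u v, d u v <= d' u v + delta) ->
  (forall u v, d' u v <= d u v + delta) ->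
  interleaved (VR F d) (VR F d') delta.
Proof.
move=> delta0 dd' d'd.
have id_shift (d1 d2 : pseudometric R T) :
    (forall u v, d2 u v <= d1 u v + delta) ->
    @shift_map R F (VR F d1) (VR F d2) delta (fun _ _ x => x).
  move=> d12; split=> // t k x /vr_ell_leP xt; apply/vr_ell_leP => s xs.
  have := xt s xs; rewrite !lee_fin => st.
  apply: le_trans (diam_le_add (val s) delta0 d12) _.
  by rewrite lerD2r.
by exists (fun _ _ x => x), (fun _ _ x => x); split=> //; exact: id_shift.
Qed.

Lemma interleaving_le_hausdorff (X Y : finMetricType R) (W : metricType R)
    (i : X -> W) (j : Y -> W) (eta : R) : (0 < #|X|)%N ->
  isometric_embedding i -> isometric_embedding j ->
  (hausdorff_dist (range i) (range j) < eta%:E)%E ->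
  (pullback_interleaving F X Y <= (2 * eta)%:E)%E.
Proof.
move=> /card_gt0P[x0 _] isoi isoj; rewrite /hausdorff_dist gt_max => /andP[hX hY].
have nearX x : exists y, mdist (i x) (j y) < eta.
  have : (ereal_inf [set (mdist (i x) b)%:E | b in range j] < eta%:E)%E.
    apply: le_lt_trans hX; apply: ereal_sup_ubound.
    by exists (i x) => //; exists x.
  by move=> /ereal_inf_lt[_ [_ [y _ <-] <-]]; rewrite lte_fin; exists y.
have nearY y : exists x, mdist (i x) (j y) < eta.
  have : (ereal_inf [set (mdist a (j y))%:E | a in range i] < eta%:E)%E.
    apply: le_lt_trans hY; apply: ereal_sup_ubound.
    by exists (j y) => //; exists y.
  by move=> /ereal_inf_lt[_ [_ [x _ <-] <-]]; rewrite lte_fin; exists x.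
(* A point of the nonempty space [X] has a partner in [Y], and [eta] exceeds their distance. *)
have eta0 : 0 <= 2 * eta.
  by have [y xy] := nearX x0; rewrite mulr_ge0// (le_trans (mdist_ge0 _ _) (ltW xy)).
(* [nearX] and [nearY] make both projections surjective; comparing distances between two pairs of
   [Z] costs [eta] once per pair. *)
pose Z : finType := {p : X * Y | mdist (i p.1) (j p.2) < eta}.
pose phiX (p : Z) : X := (val p).1; pose phiY (p : Z) : Y := (val p).2.
apply: (@le_trans _ _ (interleaving_dist
    (VR F (pullback (metric_pseudometric X) phiX))
    (VR F (pullback (metric_pseudometric Y) phiY)))).
  apply: ereal_inf_lbound; exists Z, phiX, phiY; split=> //.
    by move=> x _; have [y xy] := nearX x; exists (exist _ (x, y) xy).
  by move=> y _; have [x xy] := nearY y; exists (exist _ (x, y) xy).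
apply: ereal_inf_lbound; exists (2 * eta) => //; split=> //.
have lt2 (p : Z) : mdist (i (phiX p)) (j (phiY p)) <= eta by exact/ltW/(valP p).
apply: identity_interleaved => // p q /=.
  rewrite -isoi -isoj; have := lt2 p; have := lt2 q.
  have := metric_triangle (i (phiX p)) (j (phiY p)) (i (phiX q)).
  have := metric_triangle (j (phiY p)) (j (phiY q)) (i (phiX q)).
  rewrite [mdist (j (phiY q)) _]metric_sym => h1 h2 h3 h4; lra.
rewrite -isoi -isoj; have := lt2 p; have := lt2 q.
have := metric_triangle (j (phiY p)) (i (phiX p)) (j (phiY q)).
have := metric_triangle (i (phiX p)) (i (phiX q)) (j (phiY q)).
rewrite [mdist (j (phiY p)) (i _)]metric_sym => h1 h2 h3 h4; lra.
Qed.

Lemma interleaving_le_gromov_hausdorff (X Y : finMetricType R) :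
  (0 < #|X|)%N ->
  (pullback_interleaving F X Y <= 2%:E * gromov_hausdorff X Y)%E.
Proof.
move=> X0; have le2 (eta : R) : (gromov_hausdorff X Y < eta%:E)%E ->
    (pullback_interleaving F X Y <= (2 * eta)%:E)%E.
  by move=> /ereal_inf_lt[_ [W [i [j [isoi isoj ->]]]]]; exact: interleaving_le_hausdorff.
case E : (gromov_hausdorff X Y) le2 => [r| |] le2.
(* Half of [e], because [le2] doubles its argument. *)
- apply/lee_addgt0Pr => e e0; apply: le_trans (le2 (r + e / 2) _) _.
    by rewrite lte_fin ltrDl divr_gt0.
  by rewrite lee_fin; lra.
- by rewrite mulry gtr0_sg// mul1e leey.
(* The value [-oo] is impossible: [eta = -1] would bound a nonnegative distance by -2. *)
- have := le2 (-1) (ltNyr _); rewrite leNgt => /negP[].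
  apply: (@lt_le_trans _ _ 0%E); first by rewrite lte_fin; lra.
  apply: le_ereal_inf_tmp => _ [Z [phiX [phiY [_ _ ->]]]].
  by apply: le_ereal_inf_tmp => _ [delta [delta0 _] <-]; rewrite lee_fin.
Qed.

End Stability.

Theorem theorem3 (R : realType) (F : fieldType) (X Y : finMetricType R)
    (hX : (0 < #|X|)%N) (hY : (0 < #|Y|)%N) (k : nat) :
  [/\ (bottleneck_dist (concise_bars F (metric_pseudometric X) k)
                       (concise_bars F (metric_pseudometric Y) k)
         <= pullback_bottleneck F X Y k)%E,
      (pullback_bottleneck F X Y k <= pullback_interleaving F X Y)%E
    & (pullback_interleaving F X Y <= 2%:E * gromov_hausdorff X Y)%E].
Proof.
split; [exact: bottleneck_le_pullback|exact: pullback_le_interleaving|].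
exact: interleaving_le_gromov_hausdorff.
Qed.
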